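(* Let $P\subseteq\mathbb{P}^3$ be a three-dimensional polytope with at most eight facets such that the facet hyperplane arrangement $\mathcal{H}_P$ is simple. Then its adjoint polynomial $\alpha_P$ has a determinantal representation. In particular, for any three-dimensional polytope with simple facet hyperplane arrangement whose adjoint hypersurface is smooth, the adjoint polynomial has a determinantal representation.
   Context: A polytope $P\subseteq\mathbb{P}^3$ (complex projective space) is a convex full-dimensional polytope inside the real points of some affine chart. $\mathcal{H}_P$ denotes the arrangement of the Zariski closures in $\mathbb{P}^3$ of the facets of $P$; it is simple if any $i$ of its planes intersect in codimension $i$ for $i\le 3$ and have empty intersection for $i>3$. The residual arrangement $\mathcal{R}(P)$ is the collection of all intersections of planes in $\mathcal{H}_P$ that do not contain a face of $P$. If $P$ has $k$ facets and $\mathcal{H}_P$ is simple, then (known result) there is a unique surface of degree $k-4$ containing $\mathcal{R}(P)$; this is the adjoint hypersurface $A_P$, and its defining polynomial, unique up to a nonzero scalar, is the adjoint polynomial $\alpha_P$ (a nonzero constant if $k=4$). A determinantal representation of a homogeneous polynomial $f\in\mathbb{C}[x_0,\dots,x_3]$ of degree $d$ is a $d\times d$ matrix $M$ whose entries are polynomials of degree at most one with complex coefficients (equivalently, for existence: homogeneous linear forms) such that $f=\det M$. *)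

(* Defs.v *)
From mathcomp Require Import all_boot all_order all_algebra.
From mathcomp Require Import boolp classical_sets functions cardinality reals.
From mathcomp Require Import complex mpoly.

Set Implicit Arguments.
Unset Strict Implicit.
Unset Printing Implicit Defensive.

Import Order.TTheory GRing.Theory Num.Theory.

Local Open Scope classical_set_scope.
Local Open Scope card_scope.
Local Open Scope ring_scope.

(** Points of the complex projective space P^3 are given by homogeneous
    coordinates, i.e. by nonzero row vectors in C^4 up to scaling, and a subset
    of P^3 by the set of all homogeneous coordinates of its points.

    The real points of the affine chart {l <> 0}, with l a nonzero real linear
    form (a column vector), are identified with the affine hyperplane {l = 1} of
    R^4: each such point has a unique real representative x with l(x) = 1. *)

Section RealPolytopes.
Variable R : realType.

Definition convex_hull (n : nat) (v : 'I_n -> 'rV[R]_4) : set 'rV[R]_4 :=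
  [set x | exists w : 'I_n -> R,
     [/\ forall i, 0 <= w i, \sum_i w i = 1 & x = \sum_i w i *: v i]].

Definition is_span (F : set 'rV[R]_4) (A : 'M[R]_4) : Prop :=
  (forall x, F x -> (x <= A)%MS) /\
  (forall B : 'M[R]_4, (forall x, F x -> (x <= B)%MS) -> (A <= B)%MS).

(** For F inside {l = 1} the affine hull of F is the trace of its linear span,
    whose dimension is therefore one more than that of F. *)
Definition has_dim (F : set 'rV[R]_4) (d : nat) : Prop :=
  exists A : 'M[R]_4, is_span F A /\ \rank A = d.+1.

Definition polytope3 (P : set 'rV[R]_4) : Prop :=
  exists l : 'cV[R]_4, exists n : nat, exists v : 'I_n -> 'rV[R]_4,
    [/\ forall i, (v i *m l) 0 0 = 1, P = convex_hull v & has_dim P 3].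

(** Nonempty faces, P included (h = 0). Every affine function on {l = 1} is the
    restriction of a linear form h. *)
Definition face (P F : set 'rV[R]_4) : Prop :=
  F !=set0 /\
  exists h : 'cV[R]_4,
    (forall x, P x -> 0 <= (x *m h) 0 0) /\
    F = [set x | P x /\ (x *m h) 0 0 = 0].

Definition facets (P : set 'rV[R]_4) : set (set 'rV[R]_4) :=
  [set F | face P F /\ has_dim F 2].

Definition complex_points (F : set 'rV[R]_4) : set 'rV[R[i]]_4 :=
  [set map_mx (real_complex R) x | x in F].

End RealPolytopes.

Section Arrangements.
Variable R : realType.
Local Notation C := R[i].

Definition zariski_closure (S : set 'rV[C]_4) : set 'rV[C]_4 :=
  [set x | x != 0 /\
     forall (d : nat) (f : {mpoly C[4]}), f \is d.-homog ->
       (forall y, S y -> f.@[y 0] = 0) -> f.@[x 0] = 0].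

Definition facet_arrangement (P : set 'rV[R]_4) : set (set 'rV[C]_4) :=
  [set zariski_closure (complex_points F) | F in facets P].

Definition intersection (S : set (set 'rV[C]_4)) : set 'rV[C]_4 :=
  [set x | x != 0 /\ forall H, S H -> H x].

(** L is a linear subspace of P^3 of codimension i. *)
Definition linear_codim (i : nat) (L : set 'rV[C]_4) : Prop :=
  exists V : 'M[C]_4,
    \rank V = (4 - i)%N /\ L = [set x | x != 0 /\ (x <= V)%MS].

Definition simple_arrangement (A : set (set 'rV[C]_4)) : Prop :=
  forall (i : nat) (S : set (set 'rV[C]_4)), S `<=` A -> S #= `I_i ->
    ((i <= 3)%N -> linear_codim i (intersection S)) /\
    ((3 < i)%N -> intersection S = set0).

Definition residual_arrangement (P : set 'rV[R]_4) : set (set 'rV[C]_4) :=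
  [set L | (exists2 S, S `<=` facet_arrangement P & L = intersection S) /\
           forall F, face P F -> ~ (complex_points F `<=` L)].

(** The polynomial f defines a surface of degree k - 4 containing R(P), where k
    is the number of facets of P. *)
Definition adjoint_polynomial (P : set 'rV[R]_4) (k : nat)
    (f : {mpoly C[4]}) : Prop :=
  [/\ facets P #= `I_k, f != 0, f \is (k - 4).-homog &
      forall L, residual_arrangement P L -> forall x, L x -> f.@[x 0] = 0].

Definition smooth_hypersurface (f : {mpoly C[4]}) : Prop :=
  forall x : 'rV[C]_4, x != 0 -> f.@[x 0] = 0 ->
    exists i : 'I_4, (f^`M(i)).@[x 0] != 0.

Definition determinantal_representation (d : nat) (f : {mpoly C[4]})
    (M : 'M[{mpoly C[4]}]_d) : Prop :=
  (forall i j, (msize (M i j) <= 2)%N) /\ f = \det M.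

(** The adjoint polynomial is only defined up to a nonzero scalar c. For d > 0
    the factor c can be absorbed in a row of M; it only matters for d = 0, where
    f is a nonzero constant and the determinant of the 0 x 0 matrix is 1. *)
Definition has_determinantal_representation (d : nat) (f : {mpoly C[4]}) :
    Prop :=
  exists c : C, c != 0 /\
    exists M : 'M[{mpoly C[4]}]_d, determinantal_representation (c *: f) M.

Lemma has_determinantal_representation_pos (d : nat) (f : {mpoly C[4]}) :
  (0 < d)%N -> has_determinantal_representation d f ->
  exists M : 'M[{mpoly C[4]}]_d, determinantal_representation f M.
Proof.
case: d => // d _ [c [c0 [M [Msz Mdet]]]].
pose D : 'M[{mpoly C[4]}]_d.+1 :=
  diag_mx (\row_i if i == 0 then (c^-1)%:MP else 1).
exists (D *m M); split.
  move=> i j; rewrite mul_diag_mx !mxE; case: ifP => _; last by rewrite mul1r.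
  by rewrite mul_mpolyC (leq_trans (msizeZ_le _ _)).
rewrite det_mulmx -Mdet det_diag big_ord_recl mxE eqxx big1 => [|i _].
  by rewrite mulr1 mul_mpolyC scalerA mulVf // scale1r.
by rewrite mxE.
Qed.

End Arrangements.

(* Main.v *)
(* The adjoint polynomial f vanishes on the line where the planes of two
   nonadjacent facets meet. Let k be the number of facets and n = k - 5, and
   suppose that there are distinct facets a_1, ..., a_n, b_1, ..., b_n such that
   a_i and b_j are nonadjacent for i <= j. The ideal of the union of the
   corresponding lines is generated by the products
   a_1 ... a_t b_(t+1) ... b_n, which are the maximal minors of a bidiagonal
   matrix; hence f = \sum_t c_t a_1 ... a_t b_(t+1) ... b_n with linear c_t is the
   determinant of this matrix extended by the column of the c_t. On the other
   hand f is singular at the point common to three pairwise nonadjacent facets.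

   It remains to find such facets a_i, b_j for k <= 8 and three pairwise
   nonadjacent facets for k >= 9. The facet adjacencies are those of the
   boundary complex of the dual simplicial polytope; inserting its vertices one
   at a time, all complexes that can occur are found by a finite search. *)

From mathcomp Require Import all_boot.
From mathcomp Require Import boolp zify.

Set Implicit Arguments.
Unset Strict Implicit.
Unset Printing Implicit Defensive.

(** * Boundary complexes of simplicial polytopes *)

(** The search has to speak of subfamilies of the facets. For a list [s] of facets, edges and
    triangles are read off from the cone cut out by the inequalities in [s] alone; dropping an
    inequality deletes a vertex of the dual polytope. This enlarges the cone, so edges and triangles
    among the remaining vertices persist. Hence nonadjacency within a subfamily carries over to the
    whole family, and nine facets settle every k >= 9. The search must also be free of coordinates.
    Convexity enters it only through a few combinatorial laws: persistence under deletion, exactly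
    two triangles on each edge, a triangle at each vertex. They force the link of an inserted vertex
    to have degrees 0 or 2 and to be connected, which leaves few cases. The number n = k - 5 comes
    from the degree: f has degree k - 4 = n + 1, the products have n factors, and one linear factor
    is left for each c_t. *)

(* [edge s] and [face s] stand for the edges and triangles in the boundary of the
   simplicial polytope with vertices [s]. *)
Record face_system (I : eqType) (edge : seq I -> I -> I -> Prop)
    (face : seq I -> I -> I -> I -> Prop) : Prop := FaceSystem {
  face_swap12 : forall s i j l, face s i j l -> face s j i l;
  face_swap23 : forall s i j l, face s i j l -> face s i l j;
  face_sub : forall s s' i j l,
    {subset s' <= s} -> face s i j l -> face s' i j l;
  edge_sub : forall s s' i j, {subset s' <= s} -> edge s i j -> edge s' i j;
  face_edge : forall s i j l, uniq [:: i; j; l] ->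
    i \in s -> j \in s -> l \in s -> face s i j l -> edge s i j;
  edge_faces : forall s i j, uniq s -> 3 < size s -> i \in s -> j \in s ->
    i != j -> edge s i j -> exists c d,
    [/\ c \in s, d \in s & uniq [:: i; j; c; d]] /\
    [/\ face s i j c, face s i j d & forall x, x \in s -> x != i -> x != j ->
       face s i j x -> x = c \/ x = d];
  vertex_face : forall s i, uniq s -> 3 < size s -> i \in s -> exists j l,
    [/\ j \in s, l \in s, uniq [:: i; j; l] & face s i j l];
  simplex_face : forall s i j l, uniq s -> size s = 4 ->
    i \in s -> j \in s -> l \in s -> uniq [:: i; j; l] -> face s i j l
}.

(** * Computable search for complexes with one more vertex *)

Definition triple := (nat * nat * nat)%type.

Definition on (t : triple) i :=
  let: (a, b, c) := t in if i == a then true else if i == b then true else i == c.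

(* [vm_compute] evaluates both arguments of [||] and of [&&]; [any], [every] and
   the nested conditionals below stop early. *)
Fixpoint any (T : Type) (p : pred T) (s : seq T) :=
  if s is x :: s' then if p x then true else any p s' else false.

Lemma anyE (T : Type) (p : pred T) s : any p s = has p s.
Proof. by elim: s => //= x s ->; case: (p x). Qed.

Fixpoint every (T : Type) (p : pred T) (s : seq T) :=
  if s is x :: s' then if p x then every p s' else false else true.

Lemma everyE (T : Type) (p : pred T) s : every p s = all p s.
Proof. by elim: s => //= x s ->; case: (p x). Qed.

Definition joined (tau : seq triple) i j :=
  any (fun t => if on t i then on t j else false) tau.

Definition in_complex (tau : seq triple) i j l :=
  any (fun t => if on t i then if on t j then on t l else false else false) tau.

Lemma joinedP tau i j :
  reflect (exists2 t, t \in tau & on t i && on t j) (joined tau i j).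
Proof.
rewrite /joined anyE; apply: (iffP hasP) => -[t tT H]; exists t => //;
by move: H; case: (on t i).
Qed.

Lemma in_complexP tau i j l :
  reflect (exists2 t, t \in tau & [&& on t i, on t j & on t l])
          (in_complex tau i j l).
Proof.
rewrite /in_complex anyE; apply: (iffP hasP) => -[t tT H]; exists t => //;
by move: H; case: (on t i); case: (on t j).
Qed.

Lemma in_complex_joined tau i j l : in_complex tau i j l -> joined tau i j.
Proof.
by case/in_complexP=> t tT /and3P[ti tj _]; apply/joinedP; exists t; rewrite ?ti.
Qed.

Arguments on : simpl never.

Lemma onE a b c i : on (a, b, c) i = (i \in [:: a; b; c]).
Proof. by rewrite /on !inE; case: (i == a); case: (i == b). Qed.

Definition wf_triple n (t : triple) :=
  let: (a, b, c) := t in [&& uniq [:: a; b; c], a < n, b < n & c < n].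

Fixpoint splits (tau : seq triple) : seq (seq triple * seq triple) :=
  if tau is t :: tau' then
    flatten [seq [:: (t :: de.1, de.2); (de.1, t :: de.2)] | de <- splits tau']
  else [:: ([::], [::])].

Lemma splits_filter (p : pred triple) tau :
  (filter p tau, filter (predC p) tau) \in splits tau.
Proof.
elim: tau => //= t tau IH.
apply/flattenP; exists [:: (t :: filter p tau, filter (predC p) tau);
  (filter p tau, t :: filter (predC p) tau)].
  by apply/mapP; exists (filter p tau, filter (predC p) tau).
by case: (p t) => /=; rewrite !inE eqxx // orbT.
Qed.

(* Below, [D] consists of the triangles of a complex that disappear when the vertex
   [n] is added, and [E] of those that stay. *)
Definition horizon (D E : seq triple) i j :=
  if joined D i j then joined E i j else false.

Lemma horizonE D E i j : horizon D E i j = joined D i j && joined E i j.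
Proof. by rewrite /horizon; case: joined. Qed.

(** The beneath-beyond construction: the region visible from the new vertex is replaced by the cone
    over its boundary. *)
Definition cone_over n (D E : seq triple) : seq triple :=
  E ++ [seq (ij.1, ij.2, n) | ij <- [seq (i, j) | j <- iota 0 n, i <- iota 0 j]
                            & horizon D E ij.1 ij.2].

(** [rem] leaves out [u] itself, because [horizon D E u u] merely says that [u] lies on triangles of
    both kinds. *)
Definition link_deg n D E u := count (horizon D E u) (rem u (iota 0 n)).

Definition link_step n D E (C : seq nat) :=
  [seq u <- iota 0 n | any (fun a => if a == u then true else horizon D E u a) C].

(* [C] is a connected component of the link of [n]. *)
Definition split_link n D E :=
  let L := [seq u <- iota 0 n | link_deg n D E u != 0] in
  let C := iter n (link_step n D E) (take 1 L) in
  [&& C != [::], uniq C, all (fun a => a < n) C,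
    all (fun a => 1 < count (horizon D E a) (rem a C)) C
    & has (fun d => d \notin C) L].

(** A split that fails one of the three tests cannot come from a face system, so it counts as
    passed. *)
Definition admissible n D E (good : seq triple -> bool) :=
  if every (fun u => link_deg n D E u \in [:: 0; 2]) (iota 0 n) then
    let sigma := cone_over n D E in
    if every (fun u => any (on^~ u) sigma) (iota 0 n.+1) then
      if split_link n D E then true else good sigma
    else true
  else true.

Definition check_step n good tau :=
  all (wf_triple n) tau && all (fun de => admissible n de.1 de.2 good) (splits tau).

Definition relabels n sigma tau (m : seq nat) :=
  [&& size m == n, uniq m, all (fun x => x < n) m &
    all (fun l => all (fun j => all (fun i =>
      in_complex sigma (nth 0 m i) (nth 0 m j) (nth 0 m l)
        == in_complex tau i j l)
      (iota 0 j)) (iota 0 l)) (iota 0 n)].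

(** Backtracking over the images of 0, 1, ..., pruned by the number of triangles at a vertex. The
    final call of [relabels] checks the whole relabelling again, so soundness does not rest on the
    pruning. *)
Fixpoint isomorphic fuel n sigma tau (m : seq nat) :=
  if fuel is fuel'.+1 then
    any (fun x => let k := size m in
      if x \in m then false else
      if count (on^~ x) sigma != count (on^~ k) tau then false else
      if every (fun j => every (fun i =>
        in_complex sigma (nth 0 m i) (nth 0 m j) x == in_complex tau i j k)
        (iota 0 j)) (iota 0 k)
      then isomorphic fuel' n sigma tau (rcons m x) else false) (iota 0 n)
  else relabels n sigma tau m.

Lemma isomorphicP fuel n sigma tau m : isomorphic fuel n sigma tau m ->
  exists m', relabels n sigma tau m'.
Proof.
elim: fuel m => [|fuel IH] m /=; first by exists m.
rewrite anyE => /hasP[x _]; case: (x \in m) => //; case: (_ != _) => //.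
by case: ifP => // _ /IH.
Qed.

Definition iso_among n types sigma := any (fun tau => isomorphic n n sigma tau [::]) types.

(** Pairs are put in front: a new [a] must be nonadjacent to all of [B] and to the new [b], while
    [b] may be joined to the older members of [A]. This is the condition i <= j on the indices. *)
Fixpoint half_graph m n sigma (A B : seq nat) :=
  if m is m'.+1 then
    any (fun a => if a \in A ++ B then false else
      if any (joined sigma a) B then false else
      any (fun b => if b \in a :: A ++ B then false else
        if joined sigma a b then false
        else half_graph m' n sigma (a :: A) (b :: B)) (iota 0 n)) (iota 0 n)
  else true.

Definition anticlique n sigma :=
  any (fun k => any (fun j => if joined sigma j k then false else
    any (fun i => if joined sigma i j then false else ~~ joined sigma i k)
      (iota 0 j)) (iota 0 k)) (iota 0 n).

(* The boundary complexes of the simplicial 3-polytopes with 4, ..., 8 vertices up to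
   relabelling; for 8 vertices only the three complexes are listed in which no
   three vertices are pairwise nonadjacent. *)
Definition complexes4 : seq (seq triple) := [:: [:: (0,1,2); (0,1,3); (0,2,3); (1,2,3)]].
Definition complexes5 : seq (seq triple) :=
  [:: [:: (0,1,3); (0,2,3); (1,2,3); (0,1,4); (0,2,4); (1,2,4)]].
Definition complexes6 : seq (seq triple) :=
  [:: [:: (0,2,3); (1,2,3); (0,1,4); (0,2,4); (1,2,4); (0,1,5); (0,3,5); (1,3,5)];
      [:: (0,2,3); (1,2,3); (0,2,4); (1,2,4); (0,3,5); (0,4,5); (1,3,5); (1,4,5)]].
Definition complexes7 : seq (seq triple) :=
  [:: [:: (1,2,3); (0,1,4); (0,2,4); (1,2,4); (0,1,5); (0,3,5); (1,3,5); (0,2,6); (0,3,6); (2,3,6)];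
      [:: (0,1,4); (0,2,4); (1,2,4); (0,1,5); (0,3,5); (1,3,5); (0,2,6); (0,3,6); (1,2,6); (1,3,6)];
      [:: (0,2,3); (1,2,3); (0,1,4); (1,2,4); (0,1,5); (0,3,5); (1,3,5); (0,2,6); (0,4,6); (2,4,6)];
      [:: (1,2,3); (0,1,4); (1,2,4); (0,1,5); (0,3,5); (1,3,5); (0,3,6); (0,4,6); (2,3,6); (2,4,6)];
      [:: (0,2,3); (1,2,3); (0,2,4); (1,2,4); (0,3,5); (1,3,5); (0,4,6); (0,5,6); (1,4,6); (1,5,6)]].
Definition complexes8 : seq (seq triple) :=
  [:: [:: (0,2,3); (0,3,5); (1,3,5); (0,2,6); (0,4,6); (2,4,6); (0,4,7);
          (0,5,7); (1,3,7); (1,5,7); (2,3,7); (2,4,7)];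
      [:: (0,2,3); (1,2,3); (1,2,4); (1,3,5); (0,2,6); (0,4,6); (2,4,6);
          (0,3,7); (0,4,7); (1,4,7); (1,5,7); (3,5,7)];
      [:: (1,2,3); (0,1,4); (1,2,4); (0,1,5); (1,3,5); (0,4,6); (2,4,6);
          (0,5,7); (0,6,7); (2,3,7); (2,6,7); (3,5,7)]].

Lemma complexes4_extensions : all (check_step 4 (iso_among 5 complexes5)) complexes4.
Proof. by vm_compute. Qed.
Lemma complexes5_extensions : all (check_step 5 (iso_among 6 complexes6)) complexes5.
Proof. by vm_compute. Qed.
Lemma complexes6_extensions : all (check_step 6 (iso_among 7 complexes7)) complexes6.
Proof. by vm_compute. Qed.
(** The facets are sought in each extension directly, which avoids a complete list of the types with
    eight vertices. *)
Lemma complexes7_extensions_half_graph :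
  all (check_step 7 (fun sigma => half_graph 3 8 sigma [::] [::])) complexes7.
Proof. by vm_compute. Qed.
Lemma complexes7_extensions :
  all (check_step 7 (fun sigma =>
    if anticlique 8 sigma then true else iso_among 8 complexes8 sigma)) complexes7.
Proof. by vm_compute. Qed.
Lemma complexes8_anticlique : all (check_step 8 (anticlique 9)) complexes8.
Proof. by vm_compute. Qed.
Lemma complexes5_half_graph : all (fun tau => half_graph 0 5 tau [::] [::]) complexes5.
Proof. by vm_compute. Qed.
Lemma complexes6_half_graph : all (fun tau => half_graph 1 6 tau [::] [::]) complexes6.
Proof. by vm_compute. Qed.
Lemma complexes7_half_graph : all (fun tau => half_graph 2 7 tau [::] [::]) complexes7.
Proof. by vm_compute. Qed.

Lemma in_complexC tau i j l : in_complex tau i j l = in_complex tau j i l.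
Proof.
by apply/in_complexP/in_complexP => -[t tT /and3P[? ? ?]]; exists t => //; apply/and3P.
Qed.

Lemma in_complexAC tau i j l : in_complex tau i j l = in_complex tau i l j.
Proof.
by apply/in_complexP/in_complexP => -[t tT /and3P[? ? ?]]; exists t => //; apply/and3P.
Qed.

Lemma joinedC tau i j : joined tau i j = joined tau j i.
Proof.
by apply/joinedP/joinedP => -[t tT /andP[? ?]]; exists t => //; apply/andP.
Qed.

Lemma horizonC D E i j : horizon D E i j = horizon D E j i.
Proof. by rewrite !horizonE !(joinedC _ i). Qed.

Lemma wf_third n t i j : wf_triple n t -> i != j -> on t i -> on t j ->
  exists c, [/\ c < n, uniq [:: i; j; c] & on t c].
Proof.
case: t => [[a b] c]; rewrite /wf_triple => /and4P[abc an bn cn] ij.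
move: abc; rewrite /= !inE negb_or andbT => /andP[/andP[ab ac] bc].
rewrite !onE !inE => /or3P[] /eqP ? /or3P[] /eqP ?; subst;
  try by rewrite eqxx in ij.
- by exists c; rewrite onE !inE !eqxx !orbT cn /= negb_or ab ac bc.
- by exists b; rewrite onE !inE !eqxx !orbT bn /= negb_or ab ac eq_sym bc.
- by exists c; rewrite onE !inE !eqxx !orbT cn /= negb_or eq_sym ab ac bc.
- by exists a; rewrite onE !inE !eqxx an /= negb_or bc !(eq_sym _ a) ab ac.
- by exists b; rewrite onE !inE !eqxx !orbT bn /= negb_or !(eq_sym c) ab ac bc.
- by exists a; rewrite onE !inE !eqxx an /= negb_or !(eq_sym _ a) ab ac eq_sym bc.
Qed.

(** * Soundness of the search for every face system *)

Section FaceSystem.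
Variables (I : eqType) (edge : seq I -> I -> I -> Prop).
Variables (face : seq I -> I -> I -> I -> Prop) (x0 : I).
Variable fs : face_system edge face.

Notation "s `_ i" := (nth x0 s i).

Definition realizes (s : seq I) tau := forall i j l,
  i < size s -> j < size s -> l < size s -> uniq [:: i; j; l] ->
  face s s`_i s`_j s`_l <-> in_complex tau i j l.

Definition face_at s (t : triple) :=
  let: (a, b, c) := t in face s s`_a s`_b s`_c.

Lemma face_at_on n s t i j l : wf_triple n t -> uniq [:: i; j; l] ->
  [&& on t i, on t j & on t l] -> face_at s t <-> face s s`_i s`_j s`_l.
Proof.
case: t => [[a b] c] _; rewrite /= !inE negb_or andbT.
move=> /andP[/andP[ij il] jl]; rewrite -!/(on (a,b,c) _) !onE !inE.
have S12 x y z : face s x y z -> face s y x z by apply: (face_swap12 fs).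
have S23 x y z : face s x y z -> face s x z y by apply: (face_swap23 fs).
case/and3P=> /or3P[] /eqP ? /or3P[] /eqP ? /or3P[] /eqP ?; subst;
  first [by rewrite eqxx in ij | by rewrite eqxx in il | by rewrite eqxx in jl | idtac].
- by [].
- by split; apply: S23.
- by split; apply: S12.
- by split=> H; [apply: S23; apply: S12 | apply: S12; apply: S23].
- by split=> H; [apply: S12; apply: S23 | apply: S23; apply: S12].
- by split=> /S12/S23/S12.
Qed.

Lemma at_most_two_faces s i j x y z : uniq s -> 3 < size s ->
  {subset [:: i; j; x; y; z] <= s} -> uniq [:: i; j; x; y; z] ->
  face s i j x -> face s i j y -> face s i j z -> False.
Proof.
move=> us s3 sub un fx fy fz.
have [Si Sj Sx Sy Sz] : [/\ i \in s, j \in s, x \in s, y \in s & z \in s].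
  by split; apply: sub; rewrite !inE eqxx ?orbT.
have uij : i != j by move: un; rewrite /= !inE; case: eqP.
have [xi xj yi yj] : [/\ x != i, x != j, y != i & y != j].
  move: un; rewrite /= !inE !negb_or !(eq_sym _ i) !(eq_sym _ j).
  by case/andP=> /and4P[_ -> -> _] /andP[/and3P[-> -> _] _].
have [zi zj] : z != i /\ z != j.
  move: un; rewrite /= !inE !negb_or !(eq_sym _ i) !(eq_sym _ j).
  by case/andP=> /and4P[_ _ _ ->] /andP[/and3P[_ _ ->] _].
have [xy [xz yz]] : x <> y /\ x <> z /\ y <> z.
  move: un; rewrite /= !inE !negb_or.
  case/and5P=> _ _ /andP[/eqP xy /eqP xz] /eqP yz _.
  by split=> //; split.
have eij : edge s i j.
  by apply: (face_edge fs _ Si Sj Sx fx); rewrite /= !inE negb_or uij !(eq_sym _ x) xi xj.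
have [c [d [_ [_ _ cd]]]] := edge_faces fs us s3 Si Sj uij eij.
move: (cd x Sx xi xj fx) (cd y Sy yi yj fy) (cd z Sz zi zj fz).
by move=> [?|?] [?|?] [?|?]; subst.
Qed.

Lemma uniq3P (T : eqType) (a b c : T) :
  reflect [/\ a != b, a != c & b != c] (uniq [:: a; b; c]).
Proof.
by rewrite /= !inE negb_or andbT -andbA; apply: and3P.
Qed.

Section AddPoint.
Variables (s : seq I) (v : I) (tau : seq triple).
Hypothesis us : uniq (rcons s v).
Hypothesis s3 : 3 < size s.
Hypothesis wft : all (wf_triple (size s)) tau.
Hypothesis rtau : realizes s tau.

Let n := size s.
Let s' := rcons s v.
Let gone t := `[< ~ face_at s' t >].
Let D := filter gone tau.
Let E := filter (predC gone) tau.

Let us0 : uniq s. Proof. by move: us; rewrite rcons_uniq => /andP[]. Qed.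
Let nv : v \notin s. Proof. by move: us; rewrite rcons_uniq => /andP[]. Qed.
Let s'3 : 3 < size s'. Proof. by rewrite size_rcons leqW. Qed.
Let subs : {subset s <= s'}.
Proof. by move=> x xs; rewrite mem_rcons inE xs orbT. Qed.
Let nthn : s'`_n = v. Proof. by rewrite nth_rcons ltnn eqxx. Qed.
Let nthl i : i < n -> s'`_i = s`_i. Proof. by rewrite nth_rcons => ->. Qed.
Let ins i : i < n -> s`_i \in s. Proof. exact: mem_nth. Qed.
Let neqs i j : i < n -> j < n -> i != j -> s`_i != s`_j.
Proof. by move=> *; rewrite nth_uniq. Qed.
Let neqv i : i < n -> s`_i != v.
Proof. by move=> i_n; apply: contraNneq nv => <-; apply: ins. Qed.
Let ins' i : i < n -> s`_i \in s'. Proof. by move=> i_n; apply/subs/ins. Qed.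
Let vs' : v \in s'. Proof. by rewrite mem_rcons inE eqxx. Qed.

Lemma old_face i j l : i < n -> j < n -> l < n -> uniq [:: i; j; l] ->
  face s' s`_i s`_j s`_l <-> in_complex E i j l.
Proof.
move=> i_n j_n l_n u; split=> [f|].
  have /(rtau i_n j_n l_n u)/in_complexP[t tT ont] := face_sub fs subs f.
  have wt := allP wft _ tT.
  apply/in_complexP; exists t => //; rewrite mem_filter tT andbT /= /gone.
  apply/asboolPn; apply: contrapT => nf; apply: nf => -[].
  by apply/(face_at_on s' wt u ont); rewrite !nthl.
case/in_complexP=> t; rewrite mem_filter /= => /andP[/asboolPn/contrapT ft tT] ont.
have wt := allP wft _ tT.
by move/(face_at_on s' wt u ont): ft; rewrite !nthl.
Qed.

Lemma gone_face i j l : i < n -> j < n -> l < n -> uniq [:: i; j; l] ->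
  in_complex D i j l <-> face s s`_i s`_j s`_l /\ ~ face s' s`_i s`_j s`_l.
Proof.
move=> i_n j_n l_n u; split.
  case/in_complexP=> t; rewrite mem_filter /= => /andP[/asboolP ft tT] ont.
  have wt := allP wft _ tT; split.
    by apply/(rtau i_n j_n l_n u)/in_complexP; exists t.
  by move=> f; apply: ft; apply/(face_at_on s' wt u ont); rewrite !nthl.
case=> /(rtau i_n j_n l_n u)/in_complexP[t tT ont] nf.
have wt := allP wft _ tT.
apply/in_complexP; exists t => //; rewrite mem_filter tT andbT /=.
apply/asboolP=> ft; apply: nf.
by move/(face_at_on s' wt u ont): ft; rewrite !nthl.
Qed.

Lemma wfD : all (wf_triple n) D.
Proof. by apply/allP=> t; rewrite mem_filter => /andP[_ /(allP wft)]. Qed.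
Lemma wfE : all (wf_triple n) E.
Proof. by apply/allP=> t; rewrite mem_filter => /andP[_ /(allP wft)]. Qed.

(** Both before and after the insertion of [v] an edge lies on exactly two triangles. If one of the
    new two contains [v], the other is a kept one, and an old triangle different from it must be
    gone, or there would be three after the insertion. Conversely, given a gone and a kept triangle,
    the second new triangle cannot be old, or there would be three before the insertion. *)
Lemma new_face i j : i < n -> j < n -> i != j ->
  face s' s`_i s`_j v <-> horizon D E i j.
Proof.
move=> i_n j_n ij; have sij := neqs i_n j_n ij.
have [iv jv] := (neqv i_n, neqv j_n).
have [/= Si Sj] := (ins i_n, ins j_n).
have [/= Si' Sj'] := (ins' i_n, ins' j_n).
split=> [f|]; rewrite horizonE.
- have es' : edge s' s`_i s`_j.
    by apply: (face_edge fs _ Si' Sj' vs' f); apply/uniq3P.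
  have es := edge_sub fs subs es'.
  have other a b : a \in s' -> b \in s' -> uniq [:: s`_i; s`_j; a; b] ->
    face s' s`_i s`_j a -> face s' s`_i s`_j b ->
    exists y, [/\ y < n, y != i, y != j & face s' s`_i s`_j s`_y].
    have H c : c \in s' -> c != v -> s`_i != c -> s`_j != c ->
       face s' s`_i s`_j c ->
       exists y, [/\ y < n, y != i, y != j & face s' s`_i s`_j s`_y].
      rewrite mem_rcons inE => /orP[->//|cs] _ ic jc fc.
      exists (index c s); rewrite index_mem nth_index //; split=> //.
        by apply: contraNneq ic => <-; rewrite nth_index.
      by apply: contraNneq jc => <-; rewrite nth_index.
    move=> as' bs' u fa fb.
    move: u; rewrite /= !inE !negb_or andbT => /and3P[/and3P[_ ia ib] /andP[ja jb] ab].
    by case: (eqVneq a v) ab => [->|av] vb; [apply: (H b) | apply: (H a)]; rewrite // eq_sym.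
  have [c [d [[cs ds u] [fc fd _]]]] := edge_faces fs us s'3 Si' Sj' sij es'.
  have [y [y_n yi yj fy]] := other c d cs ds u fc fd.
  have uy : uniq [:: i; j; y] by apply/uniq3P; rewrite ij !(eq_sym _ y).
  apply/andP; split; last first.
    by apply: (@in_complex_joined _ _ _ y); apply/old_face.
  have {c d cs ds u fc fd} [c [d [[cs ds u] [fc fd _]]]] :=
    edge_faces fs us0 s3 Si Sj sij es.
  move: u; rewrite /= !inE !negb_or andbT => /and3P[/and3P[_ ic id] /andP[jc jd] cd].
  have H z : z \in s -> s`_i != z -> s`_j != z -> z != s`_y -> face s s`_i s`_j z ->
      joined D i j.
    move=> zs iz jz zy fz; apply: (@in_complex_joined _ _ _ (index z s)).
    apply/gone_face; rewrite ?index_mem ?nth_index //.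
      apply/uniq3P; split=> //.
        by apply: contraNneq iz => ->; rewrite nth_index.
      by apply: contraNneq jz => ->; rewrite nth_index.
    split=> // fz'; apply: (@at_most_two_faces s' s`_i s`_j z s`_y v) => //.
      move=> x; rewrite !inE => /or4P[/eqP->|/eqP->|/eqP->|/orP[]/eqP->] //.
        exact: subs.
      exact: ins'.
    rewrite /= !inE !negb_or sij iz jz iv jv zy /= !andbT !neqs // ?(eq_sym _ y) //=.
    by rewrite neqv // andbT; apply: contraNneq nv => <-.
  by case: (eqVneq c s`_y) cd => [->|cy] yd; [apply: (H d) | apply: (H c)]; rewrite // eq_sym.
- case/andP=> /joinedP[t tD /andP[ti tj]] /joinedP[t' tE /andP[ti' tj']].
  have [c [c_n uc tc]] := wf_third (allP wfD _ tD) ij ti tj.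
  have [d [d_n ud td]] := wf_third (allP wfE _ tE) ij ti' tj'.
  have /(gone_face i_n j_n c_n uc)[fc nfc] : in_complex D i j c.
    by apply/in_complexP; exists t => //; apply/and3P.
  have /(old_face i_n j_n d_n ud) fd : in_complex E i j d.
    by apply/in_complexP; exists t' => //; apply/and3P.
  have [_ ic jc] := uniq3P _ _ _ uc; have [_ id jd] := uniq3P _ _ _ ud.
  have es' : edge s' s`_i s`_j.
    by apply: (face_edge fs _ Si' Sj' (ins' d_n) fd); apply/uniq3P; rewrite sij !neqs.
  have [a [b [[as' bs' u] [fa fb _]]]] := edge_faces fs us s'3 Si' Sj' sij es'.
  move: u; rewrite /= !inE !negb_or andbT => /and3P[/and3P[_ ia ib] /andP[ja jb] ab].
  have H x : x \in s' -> s`_i != x -> s`_j != x -> x != s`_d ->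
      face s' s`_i s`_j x -> face s' s`_i s`_j v.
    rewrite mem_rcons inE => /orP[/eqP -> //|xs] ix jx xd fx; exfalso.
    apply: (@at_most_two_faces s s`_i s`_j s`_c s`_d x) => //.
    + move=> y; rewrite !inE => /or4P[/eqP->|/eqP->|/eqP->|/orP[]/eqP->] //; exact: ins.
    + rewrite /= !inE !negb_or sij ix jx /= !andbT !neqs //=.
      rewrite eq_sym in xd; rewrite xd andbT /=.
      by apply/eqP=> e; apply: nfc; rewrite e.
    + by apply/eqP=> e; apply: nfc; rewrite e.
    + exact: (face_sub fs subs fd).
    + exact: (face_sub fs subs fx).
  case: (eqVneq a s`_d) ab => [->|ad] db; [apply: (H b) | apply: (H a)] => //.
  by rewrite eq_sym.
Qed.

Lemma realizes_rcons : realizes s' (cone_over n D E).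
Proof.
have cone_n i j : i < n -> j < n -> i != j ->
    in_complex (cone_over n D E) i j n = horizon D E i j.
  move=> i_n j_n ij; apply/in_complexP/idP.
    case=> t; rewrite mem_cat => /orP[tE /and3P[_ _]|].
      move: (allP wfE _ tE); case: t {tE} => [[a b] c] /and4P[_ an bn cn].
      rewrite onE !inE => /or3P[]/eqP e; move: an bn cn;
        by rewrite -e ltnn //.
    case/mapP=> -[a b]; rewrite mem_filter /= => /andP[hz /allpairsPdep[b' [a']]].
    case=> jn ai [? ?]; subst a' b' => ->; rewrite !onE !inE => /and3P[hi hj _].
    move: i_n j_n ij hi hj; rewrite !ltn_neqAle => /andP[/negPf-> _] /andP[/negPf-> _].
    rewrite !orbF => ij /orP[]/eqP ei /orP[]/eqP ej; move: ij hz; rewrite ei ej ?eqxx //.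
    by rewrite horizonC.
  wlog ltij : i j i_n j_n ij / i < j => [W hz|hz].
    case: (ltngtP i j) ij => // ltij _; first by apply: W; rewrite // ltn_eqF.
    have ji : j != i by rewrite ltn_eqF.
    have hz' : horizon D E j i by rewrite horizonC.
    have [t tT /and3P[? ? ?]] := W j i j_n i_n ji ltij hz'.
    by exists t => //; apply/and3P.
  exists (i, j, n); last by rewrite !onE !inE !eqxx !orbT.
  rewrite mem_cat; apply/orP; right; apply/mapP; exists (i, j) => //.
  rewrite mem_filter hz /=; apply/allpairsPdep; exists j, i.
  by rewrite !mem_iota.
have cone_old i j l : i < n -> j < n -> l < n -> uniq [:: i; j; l] ->
    in_complex (cone_over n D E) i j l = in_complex E i j l.
  move=> i_n j_n l_n /uniq3P[ij il jl]; apply/in_complexP/in_complexP; last first.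
    by case=> t tE ont; exists t => //; rewrite mem_cat tE.
  case=> t; rewrite mem_cat => /orP[tE|]; first by exists t.
  case/mapP=> -[a b] _ ->; rewrite !onE !inE.
  move: i_n j_n l_n; rewrite !ltn_neqAle => /andP[/negPf-> _] /andP[/negPf-> _] /andP[/negPf-> _].
  rewrite !orbF => /and3P[] /orP[]/eqP ei /orP[]/eqP ej /orP[]/eqP el;
  by move: ij il jl; rewrite ei ej el ?eqxx.
move=> i j l; rewrite size_rcons !ltnS -/n.
have S12 x y z : face s' x y z <-> face s' y x z by split; apply: (face_swap12 fs).
have S23 x y z : face s' x y z <-> face s' x z y by split; apply: (face_swap23 fs).
rewrite [i <= n]leq_eqVlt [j <= n]leq_eqVlt [l <= n]leq_eqVlt.
move=> /orP[/eqP->|i_n] /orP[/eqP->|j_n] /orP[/eqP->|l_n] /uniq3P[ij il jl];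
  first [by rewrite eqxx in ij | by rewrite eqxx in il | by rewrite eqxx in jl | idtac].
- rewrite nthn !nthl // S12 S23 in_complexC in_complexAC cone_n //.
  exact: new_face.
- rewrite nthn !nthl // S23 in_complexAC cone_n //; exact: new_face.
- rewrite nthn !nthl // cone_n //; exact: new_face.
- have u : uniq [:: i; j; l] by apply/uniq3P.
  by rewrite !nthl // cone_old //; apply: old_face.
Qed.

(** The two triangles on the edge from [u] to [v] have the link neighbours of [u] as their third
    vertices. *)
Lemma edge_link u : u < n -> edge s' s`_u v -> exists c d,
  [/\ c < n, d < n & uniq [:: u; c; d]] /\
  (forall x, x < n -> x != u -> horizon D E u x = (x == c) || (x == d)).
Proof.
move=> u_n euv; have uv := neqv u_n.
have [c [d [[cs ds U] [fc fd cd]]]] := edge_faces fs us s'3 (ins' u_n) vs' uv euv.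
move: U; rewrite /= !inE !negb_or andbT => /and3P[/and3P[_ uc ud] /andP[vc vd] ncd].
have {}cs : c \in s by move: cs; rewrite mem_rcons inE eq_sym (negPf vc).
have {}ds : d \in s by move: ds; rewrite mem_rcons inE eq_sym (negPf vd).
exists (index c s), (index d s); rewrite !index_mem; split.
  split=> //; apply/uniq3P; split.
  - by apply: contraNneq uc => ->; rewrite nth_index.
  - by apply: contraNneq ud => ->; rewrite nth_index.
  - by apply: contraNneq ncd => e; rewrite -(nth_index x0 cs) e nth_index.
move=> x x_n xu.
have ux : u != x by rewrite eq_sym.
apply/idP/idP => [hz|].
  have /(new_face u_n x_n ux) fx := hz.
  have := cd s`_x (ins' x_n) (neqs x_n u_n xu) (neqv x_n) (face_swap23 fs fx).
  by case=> e; rewrite -e index_uniq ?eqxx ?orbT.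
by case/orP=> /eqP ->; apply/new_face;
  rewrite ?index_mem ?nth_index //; do ?[exact: (face_swap23 fs)];
  apply/eqP=> e; [move: uc|move: ud]; rewrite e nth_index // eqxx.
Qed.

Lemma link_deg02 u : u < n -> link_deg n D E u \in [:: 0; 2].
Proof.
move=> u_n; rewrite /link_deg rem_filter ?iota_uniq //.
case: (pselect (edge s' s`_u v)) => [euv|neuv].
  have [c [d [[c_n d_n /uniq3P[uc ud cd]] H]]] := edge_link u_n euv.
  rewrite count_filter.
  have -> : count (predI (horizon D E u) (predC1 u)) (iota 0 n) =
            count (mem [:: c; d]) (iota 0 n).
    apply: eq_in_count => x; rewrite mem_iota /= add0n => x_n.
    rewrite !inE; case: (eqVneq x u) => [->|xu]; last by rewrite andbT H.
    by rewrite andbF (negPf uc) (negPf ud).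
  rewrite -size_filter.
  suff /perm_size -> : perm_eq [seq x <- iota 0 n | mem [:: c; d] x] [:: c; d] by [].
  apply: uniq_perm; rewrite ?filter_uniq ?iota_uniq //= ?inE ?cd //.
  move=> x; rewrite mem_filter /= mem_iota add0n /= !inE.
  case: (eqVneq x c) => [->|_] /=; first by rewrite c_n.
  by case: (eqVneq x d) => [->|_] /=; rewrite ?d_n.
rewrite (@eq_in_count _ _ pred0) ?count_pred0 // => x.
rewrite mem_filter mem_iota /= add0n => /andP[xu x_n].
apply/negP=> hz; apply: neuv.
have ux : u != x by rewrite eq_sym.
have fx : face s' s`_u s`_x v by apply/new_face.
apply: (face_edge fs _ (ins' u_n) vs' (ins' x_n) (face_swap23 fs fx)).
by apply/uniq3P; rewrite neqv // neqs // eq_sym neqv.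
Qed.

Lemma cone_covers u : u < n.+1 -> any (on^~ u) (cone_over n D E).
Proof.
move=> u_n; rewrite anyE.
have us' : s'`_u \in s' by apply: mem_nth; rewrite size_rcons.
have [j [l [js ls U f]]] := vertex_face fs us s'3 us'.
have /in_complexP[t tT /and3P[ut _ _]] : in_complex (cone_over n D E) u (index j s') (index l s').
  have [uj ul jl] := uniq3P _ _ _ U.
  apply/realizes_rcons; rewrite ?index_mem ?nth_index ?size_rcons //.
  apply/uniq3P; split.
  - by apply: contraNneq uj => ->; rewrite nth_index.
  - by apply: contraNneq ul => ->; rewrite nth_index.
  - by apply: contraNneq jl => e; rewrite -(nth_index x0 js) e nth_index.
by apply/hasP; exists t.
Qed.

(* If the link had a component [C] and another vertex [d], then restricting to [v],
   [d] and [C] would give a third triangle containing [v] and some vertex of [C]. *)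
Lemma connected_link : ~~ split_link n D E.
Proof.
rewrite /split_link; set L := filter _ _; set C := iter _ _ _.
apply/negP=> /and5P[C0 uC /allP Cn /allP deg2 /hasP[d dL dC]].
have [d_n degd] : d < n /\ link_deg n D E d != 0.
  by move: dL; rewrite mem_filter mem_iota => /andP[-> /=].
(* The test itself records every fact about [C] used below, so the way [C] was computed can be
   forgotten. *)
clearbody C.
have two a : a \in C -> exists b c, [/\ b \in C, c \in C, uniq [:: a; b; c],
    horizon D E a b & horizon D E a c].
  move=> aC; have := deg2 a aC; rewrite rem_filter // -size_filter.
  case E2: (filter _ _) => [|b [|c r]] // _.
  have ub : uniq (b :: c :: r) by rewrite -E2 !filter_uniq.
  have memb x : x \in b :: c :: r -> [/\ x \in C, x != a & horizon D E a x].
    by rewrite -E2 !mem_filter => /and3P[? ? ?]; split.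
  have [bC ba hb] := memb b (mem_head _ _).
  have [|cC ca hc] := memb c; first by rewrite !inE eqxx orbT.
  exists b, c; split=> //; apply/uniq3P; rewrite !(eq_sym a); split=> //.
  by move: ub; rewrite /= inE negb_or => /andP[/andP[]].
pose S := v :: s`_d :: [seq s`_a | a <- C].
have SC a : a \in C -> s`_a \in S.
  by move=> aC; rewrite !inE; apply/orP; right; apply/orP; right; apply: map_f.
have subS : {subset S <= s'}.
  move=> x; rewrite !inE => /or3P[/eqP->|/eqP->|/mapP[a /Cn a_n ->]] //; exact: ins'.
have uS : uniq S.
  rewrite /= inE negb_or -andbA; apply/and4P; split.
  - by rewrite eq_sym neqv.
  - by apply/mapP=> -[a /Cn a_n va]; move: nv; rewrite va ins.
  - apply/mapP=> -[a aC /eqP]; rewrite nth_uniq // ?Cn // => /eqP da.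
    by rewrite da aC in dC.
  - by rewrite map_inj_in_uniq // => a b /Cn a_n /Cn b_n /eqP; rewrite nth_uniq // => /eqP.
have [a0 a0C] : exists a, a \in C by case: (C) C0 => [|a C'] // _; exists a; apply: mem_head.
have S3 : 3 < size S.
  have [b [c [bC cC uabc _ _]]] := two a0 a0C.
  suff : 2 < size C by rewrite /= size_map !ltnS; apply: ltnW.
  apply: (@uniq_leq_size _ [:: a0; b; c] C uabc) => x.
  by rewrite !inE => /or3P[]/eqP->.
have vS : v \in S by rewrite !inE eqxx.
have dS : s`_d \in S by rewrite !inE eqxx orbT.
have edv : edge S s`_d v.
  move: degd; rewrite /link_deg -lt0n -has_count => /hasP[x].
  rewrite rem_filter ?iota_uniq // mem_filter mem_iota /= add0n => /andP[xd x_n] hz.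
  rewrite eq_sym in xd.
  have fx : face s' s`_d s`_x v by apply/new_face.
  apply: (edge_sub fs subS).
  apply: (face_edge fs _ (ins' d_n) vs' (ins' x_n) (face_swap23 fs fx)).
  by apply/uniq3P; rewrite neqv // neqs // eq_sym neqv.
(* The edge from [d] to [v] survives the restriction to [S], so it lies on a triangle there, and the
   third vertex of that triangle can only come from [C]. *)
have [x [y [[xS _ U] [fx _ _]]]] := edge_faces fs uS S3 dS vS (neqv d_n) edv.
move: U; rewrite /= !inE !negb_or => /andP[/and3P[_ dx _] /andP[/andP[vx _] _]].
move: xS; rewrite !inE eq_sym (negPf vx) eq_sym (negPf dx) /= => /mapP[a aC xa].
have a_n := Cn _ aC; rewrite {}xa in fx dx vx.
have [b [c [bC cC /uniq3P[ab ac bc] hb hc]]] := two a aC.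
have [b_n c_n] := (Cn _ bC, Cn _ cC).
have face' e : e < n -> a != e -> horizon D E a e -> face S v s`_a s`_e.
  move=> e_n ae /(new_face a_n e_n ae) fe.
  by apply: (face_sub fs subS); apply: (face_swap12 fs); apply: (face_swap23 fs).
apply: (@at_most_two_faces S v s`_a s`_b s`_c s`_d) => //.
- move=> z; rewrite 5!inE => /or4P[/eqP->|/eqP->|/eqP->|/orP[]/eqP->] //; exact: SC.
- have dn e : e \in C -> e != d by move=> eC; apply: contraNneq dC => <-.
  by rewrite /= !inE !negb_or !(eq_sym v) !neqv // !neqs // ?dn.
- exact: face'.
- exact: face'.
- by apply: (face_swap23 fs); apply: (face_swap12 fs).
Qed.

Lemma admissible_cone good :
  admissible n D E good -> good (cone_over n D E).
Proof.
rewrite /admissible !everyE; case: allP => [_|[]]; last first.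
  by move=> u; rewrite mem_iota add0n; apply: link_deg02.
case: allP => [_|[]]; last by move=> u; rewrite mem_iota add0n; apply: cone_covers.
by rewrite (negPf connected_link).
Qed.

End AddPoint.

Lemma face_eqi s s' i j l : s =i s' -> face s i j l <-> face s' i j l.
Proof.
by move=> e; split; apply: (face_sub fs) => x; rewrite e.
Qed.

Lemma realizes_relabels s sigma tau m : uniq s -> realizes s sigma ->
  relabels (size s) sigma tau m ->
  exists s', [/\ uniq s', s' =i s & realizes s' tau].
Proof.
move=> us rs /and4P[/eqP sm um /allP mn /allP M].
pose s' := [seq s`_i | i <- m].
have mN i : i < size s -> nth 0 m i < size s by move=> i_n; apply/mn/mem_nth; rewrite sm.
have us' : uniq s'.
  rewrite map_inj_in_uniq // => a b /mn a_n /mn b_n /eqP.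
  by rewrite nth_uniq // => /eqP.
have ss' : size s' = size s by rewrite size_map.
have sub : {subset s' <= s} by move=> x /mapP[a /mn a_n ->]; apply: mem_nth.
have ess : s' =i s by case: (uniq_min_size us' sub); rewrite ?ss'.
exists s'; split=> //.
have ordered i j l : i < j -> j < l -> l < size s ->
    in_complex sigma (nth 0 m i) (nth 0 m j) (nth 0 m l) = in_complex tau i j l.
  move=> ij jl l_n; have := M l; rewrite mem_iota /= add0n => /(_ l_n)/allP/(_ j).
  rewrite mem_iota /= add0n => /(_ jl)/allP/(_ i).
  by rewrite mem_iota /= add0n => /(_ ij)/eqP.
have all_orders i j l : i < size s -> j < size s -> l < size s -> uniq [:: i; j; l] ->
    in_complex sigma (nth 0 m i) (nth 0 m j) (nth 0 m l) = in_complex tau i j l.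
  move=> i_n j_n l_n /uniq3P[].
  case: (ltngtP i j) => // ij _; case: (ltngtP i l) => // il _;
  case: (ltngtP j l) => // jl _; try lia.
  - exact: ordered.
  - by rewrite in_complexAC ordered // in_complexAC.
  - by rewrite in_complexAC in_complexC ordered // in_complexC in_complexAC.
  - by rewrite in_complexC ordered // in_complexC.
  - by rewrite in_complexC in_complexAC ordered // in_complexAC in_complexC.
  - by rewrite in_complexC in_complexAC in_complexC ordered // in_complexC in_complexAC in_complexC.
move=> i j l; rewrite ss' => i_n j_n l_n u.
rewrite -all_orders // (face_eqi _ _ _ ess) /s' !(nth_map 0) ?sm //.
apply: rs; rewrite ?mN //.
by move/uniq3P: u => [ij il jl]; apply/uniq3P; rewrite !nth_uniq ?sm.
Qed.

Section Classification.
(** A hereditary property that cuts the classification down: trivial in the search for a staircase,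
    and the absence of three pairwise nonadjacent vertices in the search for those. *)
Variable Q : seq I -> Prop.
Hypothesis Qsub : forall s s', {subset s' <= s} -> Q s -> Q s'.

Definition realizable n (types : seq (seq triple)) :=
  forall s, uniq s -> size s = n -> Q s ->
  exists s' tau, [/\ uniq s', s' =i s, tau \in types & realizes s' tau].

Lemma realizable_step n types good : 3 < n -> realizable n types ->
  all (check_step n good) types ->
  forall s, uniq s -> size s = n.+1 -> Q s -> exists s' sigma,
    [/\ uniq s', s' =i s, good sigma & realizes s' sigma].
Proof.
move=> n3 R /allP chk s; case/lastP: s => // s v; rewrite rcons_uniq size_rcons.
move=> /andP[vs us] [sn] Qs.
have {Qs} : Q s by apply: Qsub Qs => x xs; rewrite mem_rcons inE xs orbT.
move=> /(R s us sn)[s' [tau [us' ess tauT rt]]].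
have /andP[wft adm] := chk tau tauT.
have sn' : size s' = n by rewrite -sn; apply/eqP; rewrite -uniq_size_uniq // => x; rewrite ess.
rewrite -sn' in wft adm n3.
have usv : uniq (rcons s' v) by rewrite rcons_uniq ess vs us'.
exists (rcons s' v); eexists; split=> //.
- by move=> x; rewrite !mem_rcons !inE ess.
- apply: (admissible_cone usv n3 wft rt).
  (* The division into triangles that really disappear and those that stay is one of the splits that
     were checked. *)
  exact: (allP adm (_, _) (splits_filter _ _)).
- exact: realizes_rcons.
Qed.

Lemma realizable_next n types types' good : 3 < n -> realizable n types ->
  all (check_step n good) types ->
  (forall s sigma, uniq s -> size s = n.+1 -> realizes s sigma -> Q s ->
     good sigma -> iso_among n.+1 types' sigma) ->
  realizable n.+1 types'.
Proof.
move=> n3 R chk goodP s us sn Qs.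
have [s' [sigma [us' ess iso rs]]] := realizable_step n3 R chk us sn Qs.
have sn' : size s' = n.+1 by rewrite -sn; apply/eqP; rewrite -uniq_size_uniq // => x; rewrite ess.
have Qs' : Q s' by apply: Qsub Qs => x; rewrite ess.
move: (goodP s' sigma us' sn' rs Qs' iso).
rewrite /iso_among anyE => /hasP[tau tauT /isomorphicP[m]].
rewrite -sn' => /(realizes_relabels us' rs)[s'' [us'' ess' rt]].
by exists s'', tau; split=> // x; rewrite ess' ess.
Qed.

Lemma realizable4 : realizable 4 complexes4.
Proof.
move=> s us s4 _; exists s, [:: (0, 1, 2); (0, 1, 3); (0, 2, 3); (1, 2, 3)].
split=> // i j l; rewrite s4 => i4 j4 l4 u; split=> _.
  by move: i j l i4 j4 l4 u => [|[|[|[|i]]]] [|[|[|[|j]]]] [|[|[|[|l]]]].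
apply: (simplex_face fs us s4); rewrite ?mem_nth ?s4 //.
by move/uniq3P: u => [ij il jl]; apply/uniq3P; rewrite !nth_uniq ?s4.
Qed.

Lemma realizable5 : realizable 5 complexes5.
Proof. exact: (realizable_next _ realizable4 complexes4_extensions). Qed.

Lemma realizable6 : realizable 6 complexes6.
Proof. exact: (realizable_next _ realizable5 complexes5_extensions). Qed.

Lemma realizable7 : realizable 7 complexes7.
Proof. exact: (realizable_next _ realizable6 complexes6_extensions). Qed.

End Classification.

(** An edge always lies on a triangle, so the triangles alone already decide nonadjacency. *)
Lemma not_joined s sigma i j : uniq s -> 3 < size s -> realizes s sigma ->
  i < size s -> j < size s -> i != j -> ~~ joined sigma i j -> ~ edge s s`_i s`_j.
Proof.
move=> us s3 rs i_n j_n ij /negP nj e; apply: nj.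
have sij : s`_i != s`_j by rewrite nth_uniq.
have [c [d [[cs _ u] [fc _ _]]]] := edge_faces fs us s3 (mem_nth _ i_n) (mem_nth _ j_n) sij e.
move: u; rewrite /= !inE !negb_or => /andP[/and3P[_ ic _] /andP[/andP[jc _] _]].
apply: (@in_complex_joined _ _ _ (index c s)).
apply/rs; rewrite ?index_mem ?nth_index //; apply/uniq3P; split=> //.
  by apply: contraNneq ic => ->; rewrite nth_index.
by apply: contraNneq jc => ->; rewrite nth_index.
Qed.

Fixpoint staircase (T : eqType) (R : T -> T -> Prop) (A B : seq T) : Prop :=
  match A, B with
  | a :: A', b :: B' => (forall x, x \in B -> R a x) /\ staircase R A' B'
  | [::], [::] => True
  | _, _ => False
  end.

Lemma staircase_map (T U : eqType) (R : T -> T -> Prop) (S : U -> U -> Prop) (f : T -> U) A B :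
  (forall x y, x \in A -> y \in B -> R x y -> S (f x) (f y)) ->
  staircase R A B -> staircase S (map f A) (map f B).
Proof.
elim: A B => [|a A IH] [|b B] //= H [Ra st]; split.
  move=> y; rewrite inE => /orP[/eqP->|/mapP[x xB ->]].
    by apply: H; rewrite ?mem_head //; apply: Ra; rewrite mem_head.
  by apply: H; rewrite ?mem_head // ?inE ?xB ?orbT //; apply: Ra; rewrite inE xB orbT.
by apply: IH st => x y xA yB; apply: H; rewrite inE ?xA ?yB orbT.
Qed.

Lemma half_graphP m n sigma A B : half_graph m n sigma A B ->
  uniq (A ++ B) -> all (fun x => x < n) (A ++ B) ->
  staircase (fun i j => ~~ joined sigma i j) A B ->
  exists A' B', [/\ size A' = m + size A, uniq (A' ++ B'), all (fun x => x < n) (A' ++ B')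
    & staircase (fun i j => ~~ joined sigma i j) A' B'].
Proof.
elim: m A B => [|m IH] A B /=; first by move=> *; exists A, B.
rewrite anyE => /hasP[a]; rewrite mem_iota /= add0n => a_n.
case: ifP => // aAB; rewrite anyE; case: ifP => // /negbT/hasPn aB.
rewrite anyE => /hasP[b]; rewrite mem_iota /= add0n => b_n.
case: ifP => // bAB; case: ifP => // /negbT ab H u AB_n st.
have [|||A' [B' [sA uA nA stA]]] := IH _ _ H.
- rewrite /= -cat_rcons -cats1 -catA /= mem_cat inE negb_or; move: u aAB bAB.
  rewrite !inE !mem_cat !cat_uniq /= !negb_or => /and3P[uA hAB uB] /norP[aA aB'] /norP[ba /norP[bA bB']].
  by rewrite (negPf aA) eq_sym (negPf ba) aB' uA bA hAB bB' uB.
- by rewrite /= a_n all_cat /= b_n; move: AB_n; rewrite all_cat.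
- split=> // x; rewrite inE => /orP[/eqP->//|xB]; exact: aB.
by exists A', B'; split=> //; rewrite sA /= addnS.
Qed.

Lemma half_graph_staircase s sigma m : uniq s -> 3 < size s -> realizes s sigma ->
  half_graph m (size s) sigma [::] [::] ->
  exists A B, [/\ size A = m, uniq (A ++ B), {subset A ++ B <= s}
    & staircase (fun i j => ~ edge s i j) A B].
Proof.
move=> us s3 rs /half_graphP[] // A [B [sA uAB /allP AB_n st]].
exists [seq s`_i | i <- A], [seq s`_i | i <- B]; rewrite -map_cat; split.
- by rewrite size_map sA addn0.
- by rewrite map_inj_in_uniq // => a b /AB_n a_n /AB_n b_n /eqP; rewrite nth_uniq // => /eqP.
- by move=> x /mapP[i /AB_n i_n ->]; apply: mem_nth.
- apply: staircase_map st => i j iA jB.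
  have iAB : i \in A ++ B by rewrite mem_cat iA.
  have jAB : j \in A ++ B by rewrite mem_cat jB orbT.
  apply: not_joined => //; rewrite ?AB_n //.
  move: uAB; rewrite cat_uniq => /and3P[_ /hasPn/(_ j jB) + _].
  by apply: contraNneq => <-.
Qed.

Lemma staircase_exists s : uniq s -> 4 < size s <= 8 ->
  exists A B, [/\ size A = size s - 5, uniq (A ++ B), {subset A ++ B <= s}
    & staircase (fun i j => ~ edge s i j) A B].
Proof.
move=> us /andP[s5 s8]; pose Q0 (_ : seq I) := True.
have QT s1 s2 : {subset s2 <= s1} -> Q0 s1 -> Q0 s2 by [].
suff [s' [us' ess [A [B [sA uAB AB st]]]]] : exists s', [/\ uniq s', s' =i s &
    exists A B, [/\ size A = size s - 5, uniq (A ++ B), {subset A ++ B <= s'}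
    & staircase (fun i j => ~ edge s' i j) A B]].
  exists A, B; split=> // [x /AB|]; first by rewrite ess.
  rewrite -(map_id A) -(map_id B); apply: staircase_map st => x y _ _ /= ne e.
  by apply: ne; apply: (edge_sub fs) e => z; rewrite ess.
have sz s' : uniq s' -> s' =i s -> size s' = size s.
  by move=> us' ess; apply/eqP; rewrite -uniq_size_uniq // => x; rewrite ess.
have conclude s' sigma m : uniq s' -> s' =i s -> realizes s' sigma ->
    half_graph m (m + 5) sigma [::] [::] -> size s = m + 5 ->
    exists s', [/\ uniq s', s' =i s &
      exists A B, [/\ size A = size s - 5, uniq (A ++ B), {subset A ++ B <= s'}
      & staircase (fun i j => ~ edge s' i j) A B]].
  move=> us' ess rs hg sm; exists s'; split=> //.
  rewrite sm addnK; apply: half_graph_staircase rs _; rewrite ?sz // ?sm //.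
  by rewrite -sm ltnW.
have [s_5|[s_6|[s_7|s_8]]] : size s = 5 \/ size s = 6 \/ size s = 7 \/ size s = 8 by lia.
- have [s' [tau [us' ess tT rt]]] := realizable5 QT us s_5 Logic.I.
  exact: (conclude s' tau 0 us' ess rt (allP complexes5_half_graph _ tT)).
- have [s' [tau [us' ess tT rt]]] := realizable6 QT us s_6 Logic.I.
  exact: (conclude s' tau 1 us' ess rt (allP complexes6_half_graph _ tT)).
- have [s' [tau [us' ess tT rt]]] := realizable7 QT us s_7 Logic.I.
  exact: (conclude s' tau 2 us' ess rt (allP complexes7_half_graph _ tT)).
- have [s' [tau [us' ess hg rt]]] :=
    realizable_step QT (isT : 3 < 7) (realizable7 QT)
      complexes7_extensions_half_graph us s_8 Logic.I.
  exact: (conclude s' tau 3 us' ess rt hg).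
Qed.

Lemma anticliqueP s sigma : uniq s -> 3 < size s -> realizes s sigma ->
  anticlique (size s) sigma -> exists x y z,
  [/\ {subset [:: x; y; z] <= s}, uniq [:: x; y; z], ~ edge s x y, ~ edge s x z & ~ edge s y z].
Proof.
move=> us s3 rs; rewrite /anticlique anyE => /hasP[k]; rewrite mem_iota add0n => /= k_n.
rewrite anyE => /hasP[j]; rewrite mem_iota add0n => /= jk; case: ifP => // /negbT njk.
rewrite anyE => /hasP[i]; rewrite mem_iota add0n => /= ij; case: ifP => // /negbT nij nik.
have j_n := ltn_trans jk k_n; have i_n := ltn_trans ij j_n; have ik := ltn_trans ij jk.
exists s`_i, s`_j, s`_k; split.
- by move=> x; rewrite !inE => /or3P[]/eqP->; apply: mem_nth.
- by apply/uniq3P; rewrite !nth_uniq // !ltn_eqF.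
- by apply: not_joined rs _ _ _ _; rewrite // ltn_eqF.
- by apply: not_joined rs _ _ _ _; rewrite // ltn_eqF.
- by apply: not_joined rs _ _ _ _; rewrite // ltn_eqF.
Qed.

(** Three nonadjacent vertices among the first nine remain nonadjacent in [s]. Having no such triple
    is hereditary, so any eight vertices of a counterexample realize one of the three types in
    [complexes8], and all extensions of these contain a triple. *)
Lemma anticlique_exists s : uniq s -> 8 < size s -> exists x y z,
  [/\ {subset [:: x; y; z] <= s}, uniq [:: x; y; z], ~ edge s x y, ~ edge s x z & ~ edge s y z].
Proof.
move=> us s9; pose Q s := ~ exists x y z,
  [/\ {subset [:: x; y; z] <= s}, uniq [:: x; y; z], ~ edge s x y, ~ edge s x z & ~ edge s y z].
have Qsub s1 s2 : {subset s2 <= s1} -> Q s1 -> Q s2.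
  move=> s21 Q1 [x [y [z [sub u xy xz yz]]]]; apply: Q1; exists x, y, z; split=> //.
  - by move=> w /sub/s21.
  - by move/(edge_sub fs s21).
  - by move/(edge_sub fs s21).
  - by move/(edge_sub fs s21).
apply: contrapT => /(Qsub s (take 9 s) (@mem_take _ _ _)) Q9.
have sz9 : size (take 9 s) = 9 by rewrite size_takel.
have R8 : realizable Q 8 complexes8.
  apply: (realizable_next Qsub _ (realizable7 Qsub) complexes7_extensions) => //.
  move=> s1 sigma us1 s1_8 rs1 Q1.
  by case: ifP => // ac; case: Q1; apply: (anticliqueP us1 _ rs1); rewrite s1_8.
have [s' [sigma [us' ess ac rs]]] :=
  realizable_step Qsub (isT : 3 < 8) R8 complexes8_anticlique (take_uniq _ us) sz9 Q9.
have sz' : size s' = 9.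
  by rewrite -sz9; apply/eqP; rewrite -uniq_size_uniq // ?take_uniq // => x; rewrite ess.
have Qs' : Q s' by apply: Qsub Q9 => x; rewrite ess.
by apply: Qs'; apply: (anticliqueP us' _ rs); rewrite sz'.
Qed.

End FaceSystem.

Require Import Defs.
From mathcomp Require Import all_boot all_order all_algebra.
From mathcomp Require Import boolp classical_sets functions cardinality reals.
From mathcomp Require Import complex mpoly ring lra.

Import Order.TTheory GRing.Theory Num.Theory.

Local Open Scope classical_set_scope.
Local Open Scope card_scope.
Local Open Scope ring_scope.

(** * Planes in general position *)

Section Forms.
Variables (R : fieldType) (I : eqType) (h : I -> 'cV[R]_4).

Definition form i (x : 'rV[R]_4) : R := (x *m h i) 0 0.

Lemma formD i x y : form i (x + y) = form i x + form i y.
Proof. by rewrite /form mulmxDl mxE. Qed.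
Lemma formZ i a x : form i (a *: x) = a * form i x.
Proof. by rewrite /form -scalemxAl mxE. Qed.
Lemma formB i x y : form i (x - y) = form i x - form i y.
Proof. by rewrite /form mulmxBl !mxE. Qed.
Lemma form0 i : form i 0 = 0.
Proof. by rewrite /form mul0mx mxE. Qed.

Definition general_position := forall s x, uniq s -> size s = 4%N ->
  (forall i, i \in s -> form i x = 0) -> x = 0.

Hypothesis gen : general_position.

Lemma gen4 i j k l x : uniq [:: i; j; k; l] ->
  form i x = 0 -> form j x = 0 -> form k x = 0 -> form l x = 0 -> x = 0.
Proof.
move=> u fi fj fk fl; apply: (gen u) => // m.
by rewrite !inE => /or4P[]/eqP->.
Qed.

Lemma form_solve i j k l a b c d : uniq [:: i; j; k; l] ->
  exists x, [/\ form i x = a, form j x = b, form k x = c & form l x = d].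
Proof.
move=> u; pose s := [:: i; j; k; l].
pose M : 'M[R]_4 := \matrix_(r, m) h (nth i s m) r 0.
have ME (x : 'rV_4) (m : 'I_4) : (x *m M) 0 m = form (nth i s m) x.
  by rewrite /form !mxE; apply: eq_bigr => r _; rewrite mxE.
have uM : M \in unitmx.
  rewrite -row_free_unit -kermx_eq0; apply/eqP/row_matrixP => r; rewrite row0.
  apply: (gen u) => // m ms.
  have m4 : (index m s < 4)%N by rewrite -[4%N]/(size s) index_mem.
  have := ME (row r (kermx M)) (Ordinal m4); rewrite /= nth_index // => <-.
  by rewrite -row_mul mulmx_ker row0 mxE.
pose v : 'rV[R]_4 := \row_m nth 0 [:: a; b; c; d] m.
have vE (m : 'I_4) : form (nth i s m) (v *m invmx M) = nth 0 [:: a; b; c; d] m.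
  by rewrite -ME mulmxKV // mxE.
exists (v *m invmx M); split.
- exact: (vE (@Ordinal 4 0 isT)).
- exact: (vE (@Ordinal 4 1 isT)).
- exact: (vE (@Ordinal 4 2 isT)).
- exact: (vE (@Ordinal 4 3 isT)).
Qed.

End Forms.

(** * The face system of a family of half-spaces *)

Section Arrangement.
Variables (R : realFieldType) (I : eqType) (h : I -> 'cV[R]_4).
Notation form := (form h).

(** The witness is a relative interior point of the common edge of two facets, dually an edge
    between two vertices. It ranges over all of R^4 and not over an affine chart, because fewer
    inequalities may cut out a region that is unbounded in the chart. *)
Definition edge_of (s : seq I) i j := exists x, [/\ form i x = 0, form j x = 0 &
  forall l, l \in s -> l != i -> l != j -> 0 < form l x].

Definition face_of (s : seq I) i j k := exists x,
  [/\ form i x = 0, form j x = 0, form k x = 0 &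
  forall l, l \in s -> l != i -> l != j -> l != k -> 0 < form l x].

Hypothesis gen : general_position h.
Hypothesis facet_point : forall i, exists x, form i x = 0 /\ forall j, j != i -> 0 < form j x.
Hypothesis large : forall s : seq I, (size s < 4)%N -> exists i, i \notin s.

Lemma small_perturbation (s : seq I) (f g : I -> R) : (forall i, i \in s -> 0 < f i) ->
  exists2 e, 0 < e & forall t i, 0 < t -> t <= e -> i \in s -> 0 < f i + t * g i.
Proof.
elim: s => [|a s IH] pos; first by exists 1.
have [e e0 He] := IH (fun i si => pos i (mem_behead (s := a :: s) si)).
have fa := pos a (mem_head _ _).
have g0 : 0 < 1 + `|g a| by have := normr_ge0 (g a); lra.
exists (Num.min e (f a / (1 + `|g a|))); first by rewrite lt_min e0 divr_gt0.
move=> t i t0; rewrite le_min => /andP[te]; rewrite ler_pdivlMr // => tf.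
rewrite inE => /orP[/eqP->|]; last exact: He.
have : - `|g a| <= g a by rewrite lerNl ler_normr lexx orbT.
nra.
Qed.

Lemma seq_argmin (s : seq I) (f : I -> R) : s != [::] ->
  exists2 c, c \in s & forall a, a \in s -> f c <= f a.
Proof.
elim: s => // a [|b s] IH _.
  by exists a; rewrite ?mem_head // => x; rewrite inE => /eqP->.
have [//|c cs Hc] := IH; have [ac|ca] := leP (f a) (f c).
  exists a; first exact: mem_head.
  by move=> x; rewrite inE => /orP[/eqP->//|/Hc]; apply: le_trans.
exists c; first by rewrite inE cs orbT.
by move=> x; rewrite inE => /orP[/eqP->|/Hc//]; apply: ltW.
Qed.

(** A small step from the vertex along the line where the forms of [i] and [j] vanish, towards
    positive values of the third form, ends inside the edge. *)
Lemma face_edge_of s i j k : uniq [:: i; j; k] -> face_of s i j k -> edge_of s i j.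
Proof.
move=> u [x [xi xj xk pos]].
have [m nm] := large (isT : (size [:: i; j; k] < 4)%N).
have u4 : uniq [:: i; j; k; m].
  by rewrite -[[:: _; _; _; _]]/(rcons [:: i; j; k] m) rcons_uniq nm.
have [y [yi yj yk _]] := form_solve gen 0 0 1 0 u4.
have pos' l : l \in [seq l <- s | [&& l != i, l != j & l != k]] -> 0 < form l x.
  by rewrite mem_filter => /andP[/and3P[? ? ?] ?]; apply: pos.
have [e e0 He] := small_perturbation (fun l => form l y) pos'.
exists (x + e *: y); rewrite !formD !formZ xi xj yi yj mulr0 addr0; split=> // l ls li lj.
rewrite formD formZ; have [->|lk] := eqVneq l k; first by rewrite xk yk; lra.
by apply: He => //; rewrite mem_filter li lj lk.
Qed.

(** By general position at most one further form vanishes at [x]. If none does, [x] lies inside the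
    edge; otherwise [x] is a vertex, and the edge starts from it. *)
Lemma nonneg_edge s i j x : i != j -> x != 0 -> form i x = 0 -> form j x = 0 ->
  (forall l, l \in s -> 0 <= form l x) -> edge_of s i j.
Proof.
move=> ij x0 xi xj nn.
case: (pselect (exists2 k, k \in s & [&& k != i, k != j & form k x == 0]));
  last first.
  move=> no; exists x; split=> // l ls li lj; rewrite lt_neqAle nn // andbT.
  by rewrite eq_sym; apply/eqP=> z; apply: no; exists l; rewrite // li lj z eqxx.
move=> [k ks /and3P[ki kj /eqP kx]].
have u : uniq [:: i; j; k] by apply/uniq3P; rewrite ij !(eq_sym _ k).
apply: (face_edge_of u); exists x; split=> // l ls li lj lk.
rewrite lt_neqAle nn // andbT eq_sym; apply: contraNneq x0 => lx.
apply/eqP; apply: (@gen4 _ _ _ gen i j k l) => //.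
by rewrite /= !inE !negb_or ij !(eq_sym _ l) (eq_sym i k) (eq_sym j k) ki kj li lj lk.
Qed.

(* On the pencil spanned by a point [p] inside the edge and another point [y], the
   end points of the edge are where the ratio of [form a y] to [form a p] is
   extremal. *)
Lemma edge_faces_of s i j : uniq s -> (3 < size s)%N -> i \in s -> j \in s ->
  i != j -> edge_of s i j -> exists c d,
    [/\ c \in s, d \in s & uniq [:: i; j; c; d]] /\
    [/\ face_of s i j c, face_of s i j d & forall x, x \in s -> x != i -> x != j ->
       face_of s i j x -> x = c \/ x = d].
Proof.
move=> us s3 si sj ij [p [pi pj pp]].
pose t := [seq l <- s | (l != i) && (l != j)].
have tE l : (l \in t) = [&& l \in s, l != i & l != j] by rewrite mem_filter andbC.
have tsize : (1 < size t)%N.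
  rewrite leqNgt; apply/negP=> t1.
  have : (size s <= size [:: i, j & t])%N.
    apply: uniq_leq_size => // l ls; rewrite !inE tE ls.
    by case: (l == i); case: (l == j).
  by rewrite /= => le; move: (leq_trans s3 le); rewrite !ltnS leqNgt t1.
have ut : uniq t by apply: filter_uniq.
have [l [m [lt mt lm]]] : exists l m, [/\ l \in t, m \in t & l != m].
  case: (t) tsize ut => [|a [|b r]] //= _; rewrite inE negb_or => /andP[/andP[ab _] _].
  by exists a, b; rewrite !inE !eqxx orbT.
have tP a : a \in t -> [/\ a \in s, a != i & a != j] by rewrite tE => /and3P.
have pt a : a \in t -> 0 < form a p by move=> /tP[? ? ?]; apply: pp.
have u4 a b : a \in t -> b \in t -> a != b -> uniq [:: i; j; a; b].
  move=> /tP[_ ai aj] /tP[_ bi bj] ab.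
  by rewrite /= !inE !negb_or ij !(eq_sym i) !(eq_sym j) ai aj bi bj ab.
(* The different values 0 and 1 at [l] and [m] keep [y] from being a multiple of [p]: such a
   multiple would be 0 by its value at [l], yet it is 1 at [m]. Hence the ratios [r] are
   distinct. *)
have [y [yi yj yl ym]] := form_solve gen 0 0 0 1 (u4 l m lt mt lm).
pose r a := form a y / form a p.
have rE a : a \in t -> form a y = r a * form a p.
  by move=> /pt pa; rewrite divfK // gt_eqF.
have rinj a b : a \in t -> b \in t -> a != b -> r a != r b.
  move=> aT bT ab; apply/eqP=> rab.
  have z0 : y - r a *: p = 0.
    by apply: (gen4 gen (u4 a b aT bT ab)); rewrite formB formZ
      ?yi ?yj ?pi ?pj ?mulr0 ?subr0 ?rE ?rab ?subrr.
  have ra0 : r a = 0.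
    have := congr1 (form l) z0; rewrite formB formZ form0 yl sub0r => /eqP.
    by rewrite oppr_eq0 mulf_eq0 (gt_eqF (pt l lt)) orbF => /eqP.
  have := congr1 (form m) z0; rewrite formB formZ form0 ym ra0 mul0r subr0.
  by move/eqP; rewrite oner_eq0.
have t0 : t != [::] by case: (t) tsize.
have [c ct cmin] := seq_argmin r t0.
have [d dt dmax'] := seq_argmin (fun a => - r a) t0.
have dmax a : a \in t -> r a <= r d by move=> /dmax'; rewrite lerN2.
have cd : c != d.
  apply/eqP=> e; have := rinj l m lt mt lm.
  have El a : a \in t -> r a = r c.
    by move=> aT; apply/eqP; rewrite eq_le cmin // andbT [in X in _ <= X]e dmax.
  by rewrite El // El // eqxx.
have [cs ci cj] := tP c ct; have [ds di dj] := tP d dt.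
have inT a : a \in s -> a != i -> a != j -> a \in t by move=> ? ? ?; rewrite tE; apply/and3P.
have slt a : a \in t -> a != c -> r c < r a.
  by move=> aT ac; rewrite lt_neqAle cmin // andbT eq_sym rinj.
have sgt a : a \in t -> a != d -> r a < r d.
  by move=> aT ad; rewrite lt_neqAle dmax // andbT rinj.
exists c, d; split; first by split=> //; apply: u4.
split.
- exists (y - r c *: p); rewrite !formB !formZ yi yj pi pj mulr0 subr0 -rE // subrr.
  split=> // a as_ ai aj ac; have aT := inT a as_ ai aj.
  rewrite formB formZ rE // -mulrBl mulr_gt0 ?pt // subr_gt0 slt //.
- exists (r d *: p - y); rewrite !formB !formZ yi yj pi pj mulr0 subr0 -rE // subrr.
  split=> // a as_ ai aj ad; have aT := inT a as_ ai aj.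
  rewrite formB formZ rE // -mulrBl mulr_gt0 ?pt // subr_gt0 sgt //.
(* For a ratio strictly between the extremes, the point [q] of the pencil on the plane of [x] has
   opposite signs at [c] and [d]. A third end point [w] would be a multiple of [q], yet be positive
   at both. *)
- move=> x xs xi xj [w [wi wj wx wpos]]; apply: contrapT => /not_orP[/eqP xc /eqP xd].
  have xT := inT x xs xi xj.
  pose q := y - r x *: p.
  have qE a : a \in t -> form a q = (r a - r x) * form a p.
    by move=> aT; rewrite formB formZ rE // -mulrBl.
  have qc : form c q < 0 by rewrite qE // pmulr_llt0 ?pt // subr_lt0 slt.
  have qd : 0 < form d q by rewrite qE // mulr_gt0 ?pt // subr_gt0 sgt.
  have wc : 0 < form c w by apply: wpos => //; rewrite eq_sym.
  have wd : 0 < form d w by apply: wpos => //; rewrite eq_sym.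
  have z0 : w - (form c w / form c q) *: q = 0.
    apply: (gen4 gen (u4 x c xT ct xc)); rewrite formB formZ ?wi ?wj ?wx.
    - by rewrite [form i q]formB formZ yi pi mulr0 subr0 mulr0 subr0.
    - by rewrite [form j q]formB formZ yj pj mulr0 subr0 mulr0 subr0.
    - by rewrite (qE x) // subrr mul0r mulr0 subr0.
    - by rewrite divfK ?subrr // lt_eqF.
  have := congr1 (form d) z0; rewrite formB formZ form0 => /eqP.
  rewrite subr_eq0 => /eqP e; move: wd; rewrite e.
  rewrite pmulr_lgt0 // pmulr_rgt0 // invr_gt0 => c0.
  by move: (lt_trans c0 qc); rewrite ltxx.
Qed.

(** Moving from the point [p] inside the facet in direction -y, the first plane met is that of [c],
    where the ratio [r] is largest; up to scaling, [w] is the point reached. It yields an edge of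
    the facet, and an edge has an end point. The value 1 of [y] at [l] makes the path meet a plane;
    the value 0 at [m] keeps [w] nonzero. *)
Lemma vertex_face_of s i : uniq s -> (3 < size s)%N -> i \in s -> exists j l,
  [/\ j \in s, l \in s, uniq [:: i; j; l] & face_of s i j l].
Proof.
move=> us s3 si; have [p [pi pp]] := facet_point i.
pose t := rem i s; have ut : uniq t by apply: rem_uniq.
have tE l : (l \in t) = (l != i) && (l \in s) by rewrite mem_rem_uniq // inE.
have ts : (2 < size t)%N by rewrite size_rem //; case: (size s) s3.
have [l [m [lt mt lm]]] : exists l m, [/\ l \in t, m \in t & l != m].
  case: (t) ts ut => [|a [|b r]] //= _; rewrite inE negb_or => /andP[/andP[ab _] _].
  by exists a, b; rewrite !inE !eqxx orbT.
have tP a : a \in t -> a \in s /\ a != i by rewrite tE => /andP[].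
have pt a : a \in t -> 0 < form a p by move=> /tP[? ?]; apply: pp.
have [[ls li] [ms mi]] := (tP l lt, tP m mt).
have u3 : uniq [:: i; l; m] by apply/uniq3P; rewrite !(eq_sym i).
have [n nn] := large (isT : (size [:: i; l; m] < 4)%N).
have u4 : uniq [:: i; l; m; n].
  by rewrite -[[:: _; _; _; _]]/(rcons [:: i; l; m] n) rcons_uniq nn.
have [y [yi yl ym _]] := form_solve gen 0 1 0 0 u4.
pose r a := form a y / form a p.
have rE a : a \in t -> form a y = r a * form a p.
  by move=> /pt pa; rewrite divfK // gt_eqF.
have t0 : t != [::] by case: (t) ts.
have [c ct cmax] := seq_argmin (fun a => - r a) t0.
pose w := r c *: p - y.
have wi : form i w = 0 by rewrite formB formZ pi yi mulr0 subr0.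
have wc : form c w = 0 by rewrite formB formZ -rE // subrr.
have [cs ci] := tP c ct.
have w0 : w != 0.
  apply/eqP=> z0; have rc0 : r c = 0.
    have := congr1 (form m) z0; rewrite formB formZ form0 ym subr0 => /eqP.
    by rewrite mulf_eq0 (gt_eqF (pt m mt)) orbF => /eqP.
  have := congr1 (form l) z0; rewrite formB formZ form0 yl rc0 mul0r sub0r.
  by move/eqP; rewrite oppr_eq0 oner_eq0.
have wn a : a \in s -> 0 <= form a w.
  move=> as_; have [->|ai] := eqVneq a i; first by rewrite wi.
  have aT : a \in t by rewrite tE ai.
  rewrite formB formZ rE // -mulrBl mulr_ge0 ?(ltW (pt _ _)) // subr_ge0.
  by rewrite -lerN2 cmax.
have ic : i != c by rewrite eq_sym.
have eic : edge_of s i c by apply: nonneg_edge ic w0 wi wc wn.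
have [a [b [[as_ bs u] [fa _ _]]]] := edge_faces_of us s3 si cs ic eic.
exists c, a; split=> //; move: u; rewrite /= !inE !negb_or andbT.
by move=> /and3P[/and3P[-> -> _] /andP[-> _] _].
Qed.

Lemma arrangement_face_system : face_system edge_of face_of.
Proof.
split.
- move=> s i j k [x [xi xj xk pos]]; exists x; split=> // l ls lj li lk; exact: pos.
- move=> s i j k [x [xi xj xk pos]]; exists x; split=> // l ls lj li lk; exact: pos.
- by move=> s s' i j k sub [x [xi xj xk pos]]; exists x; split=> // l /sub; apply: pos.
- by move=> s s' i j sub [x [xi xj pos]]; exists x; split=> // l /sub; apply: pos.
- by move=> s i j k u _ _ _; apply: face_edge_of.
- exact: edge_faces_of.
- exact: vertex_face_of.
- move=> s i j k us s4 si sj sk u.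
  have [m ms mnot] : exists2 m, m \in s & m \notin [:: i; j; k].
    apply: contrapT => no; have : (size s <= size [:: i; j; k])%N.
      apply: uniq_leq_size => // m ms; apply: contrapT => /negP mn; apply: no.
      by exists m.
    by rewrite s4.
  have u4 : uniq [:: i; j; k; m].
    by rewrite -[[:: _; _; _; _]]/(rcons [:: i; j; k] m) rcons_uniq mnot.
  have [x [xi xj xk xm]] := form_solve gen 0 0 0 1 u4.
  exists x; split=> // l ls li lj lk.
  have sub : {subset [:: i; j; k; m] <= s}.
    by move=> z; rewrite !inE => /or4P[]/eqP->.
  have := uniq_min_size u4 sub; rewrite s4 => /(_ (leqnn _))[_ /(_ l)].
  rewrite ls !inE (negPf li) (negPf lj) (negPf lk) /= => /eqP->.
  by rewrite xm ltr01.
Qed.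

End Arrangement.

(** * Polynomials vanishing on lines *)

Lemma mnm_neq0 N (m : 'X_{1..N}) : m != 0%MM -> exists i, m i != 0%N.
Proof.
move=> m0; apply: contrapT => no; case/eqP: m0; apply/mnmP=> i; rewrite mnmE.
by apply: contrapT => /eqP mi; apply: no; exists i.
Qed.

Lemma mnm_subU N (m : 'X_{1..N}) : m != 0%MM -> exists i, m = (U_(i) + (m - U_(i)))%MM.
Proof.
case/mnm_neq0=> i mi; exists i; rewrite addmC; apply/mnmP=> j; rewrite !mnmE.
by case: eqVneq => [<-|_]; rewrite ?subn0 ?addn0 // subnK // lt0n.
Qed.

Section Lines.
Variables (C : numFieldType) (N : nat).
Implicit Types (f g : {mpoly C[N]}) (x y : 'rV[C]_N).

Lemma mpoly_ring_ind (P : {mpoly C[N]} -> Prop) :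
  (forall c, P c%:MP) -> (forall i, P 'X_i) ->
  (forall f g, P f -> P g -> P (f + g)) -> (forall f g, P f -> P g -> P (f * g)) ->
  forall f, P f.
Proof.
move=> PC PX PD PM; have P1 : P 1 by rewrite -mpolyC1; apply: PC.
have Pmon m : P 'X_[m].
  rewrite mpolyXE_id; apply: (big_ind P) => // i _.
  by elim: (m i) => [|k IH]; rewrite ?expr0 // exprS; apply: PM.
elim/mpolyind => [|c m p _ _ Pp]; first by rewrite -mpolyC0; apply: PC.
by apply: PD => //; rewrite -mul_mpolyC; apply: PM.
Qed.

Lemma line_restriction f x y : exists p : {poly C},
  (forall t, p.[t] = f.@[(x + t *: y) 0]) /\
  (forall t, p^`().[t] = \sum_i y 0 i * (f^`M(i)).@[(x + t *: y) 0]).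
Proof.
elim/mpoly_ring_ind: f => [c|i|f g [p [Hp Dp]] [q [Hq Dq]]|f g [p [Hp Dp]] [q [Hq Dq]]].
- exists c%:P; split=> t; first by rewrite hornerC mevalC.
  rewrite derivC horner0 big1 // => i _.
  by rewrite mderivC meval0 mulr0.
- exists ((x 0 i)%:P + (y 0 i) *: 'X); split=> t.
    by rewrite hornerD hornerC hornerZ hornerX mevalXU !mxE mulrC.
  rewrite derivD derivC add0r derivZ derivX hornerZ hornerC mulr1.
  rewrite (bigD1 i) //= big1 ?addr0 => [|j ji].
    rewrite mderivX mnmE eqxx scale1r.
    have -> : (U_(i) - U_(i))%MM = 0%MM by apply/mnmP=> j; rewrite !mnmE subnn.
    by rewrite mpolyX0 meval1 mulr1.
  by rewrite mderivX mnmE eq_sym (negPf ji) scale0r meval0 mulr0.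
- exists (p + q); split=> t; first by rewrite hornerD Hp Hq mevalD.
  rewrite derivD hornerD Dp Dq -big_split; apply: eq_bigr => i _ /=.
  by rewrite mderivD mevalD mulrDr.
- exists (p * q); split=> t; first by rewrite hornerM Hp Hq mevalM.
  rewrite derivM hornerD !hornerM Dp Dq Hp Hq mulr_suml mulr_sumr -big_split.
  by apply: eq_bigr => i _ /=; rewrite mderivM mevalD !mevalM; ring.
Qed.

Lemma poly_nat_roots (p : {poly C}) : (forall n : nat, p.[n%:R] = 0) -> p = 0.
Proof.
move=> p0; apply/eqP; apply: contraT => pn0.
pose rs : seq C := [seq n%:R | n <- iota 0 (size p)].
have : (size rs < size p)%N.
  apply: max_poly_roots => //.
    by apply/allP=> z /mapP[n _ ->]; apply/rootP.
  by rewrite map_inj_uniq ?iota_uniq // => m n /eqP; rewrite eqr_nat => /eqP.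
by rewrite size_map size_iota ltnn.
Qed.

(** Natural parameters are the ones that the convexity of a facet supplies in [span_vanish]. *)
Lemma vanish_on_line f x y : (forall n : nat, f.@[(x + n%:R *: y) 0] = 0) ->
  forall t, f.@[(x + t *: y) 0] = 0.
Proof.
move=> f0 t; have [p [pE _]] := line_restriction f x y.
by rewrite -pE (@poly_nat_roots p) ?horner0 // => n; rewrite pE f0.
Qed.

Lemma directional_derivative f x y : (forall t, f.@[(x + t *: y) 0] = 0) ->
  \sum_i y 0 i * (f^`M(i)).@[x 0] = 0.
Proof.
move=> f0; have [p [pE dpE]] := line_restriction f x y.
have := dpE 0; rewrite (@poly_nat_roots p) => [|n]; last by rewrite pE f0.
by rewrite deriv0 horner0 scale0r addr0.
Qed.

(** On the line through [x] and [y] both factors become univariate polynomials, and that of [g] is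
    nonzero because of [y]. The other one is therefore zero, also at [x], where [g] may vanish. *)
Lemma vanish_cancel f g x y : g.@[y 0] != 0 ->
  (forall t, (g * f).@[(x + t *: (y - x)) 0] = 0) -> f.@[x 0] = 0.
Proof.
move=> gy gf; have [p [pE _]] := line_restriction f x (y - x).
have [q [qE _]] := line_restriction g x (y - x).
have /eqP : q * p = 0.
  by apply: poly_nat_roots => n; rewrite hornerM qE pE -mevalM gf.
rewrite mulf_eq0 => /orP[/eqP q0|/eqP p0].
  by move: gy; have := qE 1; rewrite q0 horner0 scale1r addrC subrK => <-; rewrite eqxx.
by have := pE 0; rewrite p0 horner0 scale0r addr0.
Qed.

(* The partial derivatives of [f] also vanish everywhere, which reduces the claim to
   the constant coefficient. *)
Lemma vanish_everywhere f : (forall x : 'rV_N, f.@[x 0] = 0) -> f = 0.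
Proof.
move=> f0; apply/mpolyP=> m; rewrite mcoeff0.
move: {-1}(mdeg m) (erefl (mdeg m)) => d; elim: d => [|d IH] in m f f0 *.
  move/eqP; rewrite mdeg_eq0 => /eqP->; rewrite -(f0 0).
  elim/mpolyind: f {f0} => [|c m' p _ _ IH]; first by rewrite mcoeff0 meval0.
  rewrite mcoeffD mevalD IH mcoeffZ mevalZ mcoeffX mevalX; congr (_ * _ + _).
  have [->|m0] := eqVneq m' 0%MM; first by rewrite big1 // => i _; rewrite mnmE expr0.
  have [i mi] := mnm_neq0 m0.
  by rewrite (bigD1 i) //= mxE expr0n (negPf mi) mul0r.
move=> dm; have [|i mE] := @mnm_subU _ m; first by rewrite -mdeg_eq0 dm.
have d0 x : f^`M(i).@[x 0] = 0.
  have := @directional_derivative f x (delta_mx 0 i) (fun t => f0 _).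
  rewrite (bigD1 i) //= big1 ?addr0 => [|j ji]; last by rewrite mxE (negPf ji) andbF mul0r.
  by rewrite mxE !eqxx mul1r.
have := IH (m - U_(i))%MM _ d0; rewrite mcoeff_mderiv addmC -mE => /(_ _)/eqP.
rewrite -mulr_natr mulf_eq0 pnatr_eq0 orbF => H; apply/eqP/H.
by move: dm; rewrite {1}mE mdegD mdeg1 add1n => -[].
Qed.
End Lines.

Section LinearForms.
Variables (C : numFieldType) (N : nat).

Definition linear_form (a : 'cV[C]_N) : {mpoly C[N]} := \sum_i a i 0 *: 'X_i.

Lemma linear_form_eval a (x : 'rV_N) : (linear_form a).@[x 0] = (x *m a) 0 0.
Proof.
rewrite /linear_form raddf_sum mxE; apply: eq_bigr => i _ /=.
by rewrite mevalZ mevalXU mulrC.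
Qed.

Lemma linear_form_homog a : linear_form a \is 1.-homog.
Proof. by apply: rpred_sum => i _; apply: rpredZ; rewrite dhomogX /= mdeg1. Qed.

(* The projection [x - a(x) u - b(x) v] onto the subspace a = b = 0 differs from
   the identity by multiples of a and b, hence so does any polynomial from its
   composition with the projection. *)
Lemma codim2_ideal (a b : 'cV[C]_N) (u v : 'rV[C]_N) d (f : {mpoly C[N]}) :
  (u *m a) 0 0 = 1 -> (u *m b) 0 0 = 0 -> (v *m a) 0 0 = 0 -> (v *m b) 0 0 = 1 ->
  f \is d.+1.-homog ->
  (forall x : 'rV_N, (x *m a) 0 0 = 0 -> (x *m b) 0 0 = 0 -> f.@[x 0] = 0) ->
  exists p q, [/\ p \is d.-homog, q \is d.-homog & f = linear_form a * p + linear_form b * q].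
Proof.
move=> ua ub va vb hf f0.
pose pr i : {mpoly C[N]} := 'X_i - (u 0 i *: linear_form a + v 0 i *: linear_form b).
pose lq := [tuple pr i | i < N].
pose prx (x : 'rV[C]_N) := x - ((x *m a) 0 0 *: u + (x *m b) 0 0 *: v).
have evpr i (x : 'rV_N) : (pr i).@[x 0] = prx x 0 i.
  rewrite mevalB mevalXU mevalD !mevalZ !linear_form_eval !mxE.
  by rewrite ![_ * u 0 i]mulrC ![_ * v 0 i]mulrC.
have pra x : (prx x *m a) 0 0 = 0.
  rewrite /prx mulmxBl mulmxDl -!scalemxAl; move: ua va; rewrite !mxE => -> ->.
  by rewrite mulr1 mulr0 addr0 subrr.
have prb x : (prx x *m b) 0 0 = 0.
  rewrite /prx mulmxBl mulmxDl -!scalemxAl; move: ub vb; rewrite !mxE => -> ->.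
  by rewrite mulr1 mulr0 add0r subrr.
have comp0 : f \mPo lq = 0.
  apply: vanish_everywhere => x; rewrite comp_mpoly_meval.
  rewrite -(f0 (prx x)) //; apply: meval_eq => i.
  by rewrite tnth_mktuple evpr.
have hpr i : pr i \is 1.-homog.
  by rewrite rpredB ?rpredD ?rpredZ ?linear_form_homog // dhomogX /= mdeg1.
pose good e (g : {mpoly C[N]}) := exists p q, [/\ p \is e.-homog, q \is e.-homog &
  g - (g \mPo lq) = linear_form a * p + linear_form b * q].
have goodmon e m : mdeg m = e.+1 -> good e 'X_[m].
  elim: e m => [|e IH] m dm.
    have /mdeg1P[i /eqP->] : mdeg m == 1%N by rewrite dm.
    exists (u 0 i)%:MP, (v 0 i)%:MP; split.
    - by rewrite -[_%:MP]mulr1 mul_mpolyC rpredZ // dhomog1.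
    - by rewrite -[_%:MP]mulr1 mul_mpolyC rpredZ // dhomog1.
    rewrite comp_mpolyXU -tnth_nth tnth_mktuple /pr opprB addrC subrK.
    by rewrite ![_ * _%:MP]mulrC !mul_mpolyC.
  have [|i mE] := @mnm_subU _ m; first by rewrite -mdeg_eq0 dm.
  have dm' : mdeg (m - U_(i))%MM = e.+1.
    by move: dm; rewrite {1}mE mdegD mdeg1 add1n => -[].
  have [p [q [hp hq E]]] := IH _ dm'.
  move: dm' E; set m' := (m - U_(i))%MM => dm' E; rewrite mE mpolyXD.
  have hm' : 'X_[C, m'] \is (e.+1).-homog by rewrite dhomogX /= dm'.
  exists (u 0 i *: 'X_[m'] + pr i * p), (v 0 i *: 'X_[m'] + pr i * q); split.
  - by rewrite rpredD ?rpredZ // -[e.+1]add1n dhomogM.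
  - by rewrite rpredD ?rpredZ // -[e.+1]add1n dhomogM.
  rewrite rmorphM /= comp_mpolyXU -tnth_nth tnth_mktuple.
  have -> : 'X_i * 'X_[m'] - pr i * ('X_[m'] \mPo lq) =
    ('X_i - pr i) * 'X_[m'] + pr i * ('X_[m'] - ('X_[m'] \mPo lq)) by ring.
  have -> : 'X_i - pr i = u 0 i *: linear_form a + v 0 i *: linear_form b.
    by rewrite /pr opprB addrC subrK.
  by rewrite E -!mul_mpolyC; ring.
have : good d f.
  rewrite (mpolyE f) big_seq; apply: (big_ind (good d)).
  - exists 0, 0; rewrite !dhomog0; split=> //.
    by rewrite comp_mpoly0 !mulr0 subrr addr0.
  - move=> g1 g2 [p1 [q1 [hp1 hq1 E1]]] [p2 [q2 [hp2 hq2 E2]]].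
    exists (p1 + p2), (q1 + q2); rewrite !rpredD //; split=> //.
    rewrite comp_mpolyD opprD addrACA E1 E2; ring.
  - move=> m mf; have [|p [q [hp hq E]]] := goodmon d m.
      exact: (dhomog_mf hf).
    exists (f@_m *: p), (f@_m *: q); rewrite !rpredZ //; split=> //.
    by rewrite comp_mpolyZ -scalerBr E scalerDr !scalerAr.
by rewrite /good comp0 subr0.
Qed.

End LinearForms.

(** * Ideals of unions of lines in an arrangement of planes *)

Section PlaneArrangement.
Variables (C : numFieldType) (I : eqType) (h : I -> 'cV[C]_4).
Hypothesis gen : general_position h.
Hypothesis large : forall s : seq I, (size s < 4)%N -> exists i, i \notin s.

Notation form := (form h).
Notation lin i := (linear_form (h i)).

Definition vanishes_on_line (f : {mpoly C[4]}) i j :=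
  forall x : 'rV_4, form i x = 0 -> form j x = 0 -> f.@[x 0] = 0.

Lemma lin_eval i (x : 'rV_4) : (lin i).@[x 0] = form i x.
Proof. exact: linear_form_eval. Qed.

Lemma line_point i j k : uniq [:: i; j; k] ->
  exists x, [/\ form i x = 0, form j x = 0 & form k x = 1].
Proof.
move=> u; have [l nl] := large (isT : (size [:: i; j; k] < 4)%N).
have u4 : uniq [:: i; j; k; l].
  by rewrite -[[:: _; _; _; _]]/(rcons [:: i; j; k] l) rcons_uniq nl.
by have [x [xi xj xk _]] := form_solve gen 0 0 1 0 u4; exists x.
Qed.

Lemma line_ideal d f i j : i != j -> f \is d.+1.-homog -> vanishes_on_line f i j ->
  exists p q, [/\ p \is d.-homog, q \is d.-homog & f = lin i * p + lin j * q].
Proof.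
move=> ij hf f0; have [k nk] := large (isT : (size [:: i; j] < 4)%N).
have [ki kj] : k != i /\ k != j by move: nk; rewrite !inE negb_or => /andP.
have u1 : uniq [:: j; k; i] by apply/uniq3P; rewrite ki !(eq_sym j) kj ij.
have u2 : uniq [:: i; k; j] by apply/uniq3P; rewrite kj eq_sym ki ij.
have [u [uj _ ui]] := line_point u1; have [v [vi _ vj]] := line_point u2.
exact: (codim2_ideal ui uj vi vj hf).
Qed.

Lemma cancel_on_line f g i j (y : 'rV_4) : form i y = 0 -> form j y = 0 -> g.@[y 0] != 0 ->
  vanishes_on_line (g * f) i j -> vanishes_on_line f i j.
Proof.
move=> yi yj gy gf x xi xj; apply: (vanish_cancel gy) => t; apply: gf.
  by rewrite formD formZ formB xi yi subrr mulr0 addr0.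
by rewrite formD formZ formB xj yj subrr mulr0 addr0.
Qed.

Lemma cancel_lin f i j k : uniq [:: i; j; k] ->
  vanishes_on_line (lin k * f) i j -> vanishes_on_line f i j.
Proof.
move=> /line_point[y [yi yj yk]]; apply: (cancel_on_line yi yj).
by rewrite lin_eval yk oner_neq0.
Qed.

Lemma prod_lin_vanish B j (x : 'rV_4) : j \in B -> form j x = 0 ->
  (\prod_(k <- B) lin k).@[x 0] = 0.
Proof.
move=> jB xj; rewrite rmorph_prod (big_rem j jB) /=.
by rewrite lin_eval xj mul0r.
Qed.

(* Modulo [lin i] the forms [lin j] are pairwise coprime, so [f] is divisible by
   their product. *)
Lemma fan_ideal f i B : uniq (i :: B) -> f \is (size B).+1.-homog ->
  (forall j, j \in B -> vanishes_on_line f i j) ->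
  exists p q, [/\ p \is (size B).-homog, q \is 1.-homog &
    f = lin i * p + (\prod_(j <- B) lin j) * q].
Proof.
elim: B f => [|b B IH] f u hf f0.
  by exists 0, f; rewrite dhomog0; split=> //; rewrite big_nil mulr0 add0r mul1r.
have ib : i != b by move: u; rewrite /= inE negb_or => /andP[/andP[]].
have [p1 [g [hp1 hg fE]]] := line_ideal ib hf (f0 b (mem_head _ _)).
have [||p2 [q [hp2 hq gE]]] := IH g _ hg.
- by move: u; rewrite /= inE negb_or => /and3P[/andP[_ ->] _ ->].
- move=> j jB; have ujb : uniq [:: i; j; b].
    move: u; rewrite /= inE negb_or => /and3P[/andP[_ nB] bB _].
    apply/uniq3P; split=> //.
      by apply: contraNneq nB => ->.
    by apply: contraNneq bB => <-.
  apply: (cancel_lin ujb) => x xi xj.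
  have -> : lin b * g = f - lin i * p1 by rewrite fE; ring.
  by rewrite mevalB mevalM lin_eval xi mul0r subr0 (f0 j) // inE jB orbT.
exists (p1 + lin b * p2), q; split=> //.
  by rewrite rpredD //; apply: (dhomogM (linear_form_homog _) hp2).
by rewrite fE gE big_cons; ring.
Qed.

End PlaneArrangement.

(** * The determinant of the extended bidiagonal matrix *)

Section StaircaseDeterminant.
Variable R : comNzRingType.

(** The signs in front of the [a i] cancel the cofactor signs, so all terms of the determinant come
    with a plus. *)
Definition staircase_mx n (a b c : nat -> R) : 'M[R]_n.+1 :=
  \matrix_(i, j) if j == 0%N :> nat then c i
                 else if i == j :> nat then b j.-1
                 else if j == i.+1 :> nat then - a i else 0.

Fixpoint staircase_sum n (a b c : nat -> R) : R :=
  if n is n'.+1 then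
    a 0%N * staircase_sum n' (a \o S) (b \o S) (c \o S) + (\prod_(i < n) b i) * c 0%N
  else c 0%N.

Lemma det_staircase n a b c : \det (staircase_mx n a b c) = staircase_sum n a b c.
Proof.
elim: n a b c => [|n IH] a b c; first by rewrite det_mx11 mxE.
rewrite (expand_det_row _ 0) big_ord_recl big_ord_recl big1 ?addr0 => [|j _]; last first.
  by rewrite !mxE /= mul0r.
rewrite !mxE /= /cofactor /= expr0 mul1r expr1 mulN1r mulrNN addrC.
congr (_ * _ + _).
- rewrite -IH; congr (\det _); apply/matrixP=> i j; rewrite !mxE /=.
  rewrite /bump /=; case: j => [[|j] jn] //=.
- rewrite mulrC; congr (_ * _).
  rewrite -det_tr det_trig.
    apply: eq_bigr => i _; rewrite !mxE /= eqxx //.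
  apply/is_trig_mxP=> i j ij; rewrite !mxE /= /bump /= !add1n.
  rewrite eqSS gtn_eqF // eqSS; case: eqVneq => // e.
  by move: ij; rewrite e ltnNge leqnSn.
Qed.
End StaircaseDeterminant.

Section StaircaseRepresentation.
Variables (C : numFieldType) (I : eqType) (h : I -> 'cV[C]_4).
Hypothesis gen : general_position h.
Hypothesis large : forall s : seq I, (size s < 4)%N -> exists i, i \notin s.

Notation form := (form h).
Notation lin i := (linear_form (h i)).
Notation lins A := (nth 0 [seq lin i | i <- A]).

Lemma staircase_size (T : eqType) (S : T -> T -> Prop) A B : staircase S A B -> size A = size B.
Proof. by elim: A B => [|a A IH] [|b B] //= [_ /IH->]. Qed.

(** For the first facet a of [A], [fan_ideal] writes f as a p plus q times the product over the
    second list; the linear form q is the first coefficient. The product vanishes on all remaining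
    lines, where a does not vanish identically, so p inherits the shorter staircase. *)
Lemma staircase_ideal A B f : uniq (A ++ B) -> f \is (size A).+1.-homog ->
  staircase (vanishes_on_line h f) A B ->
  exists c : nat -> {mpoly C[4]}, (forall t, c t \is 1.-homog) /\
    f = staircase_sum (size A) (lins A) (lins B) c.
Proof.
elim: A B f => [|a A IH] [|b B] f u hf //=; first by exists (fun _ => f).
move: u; rewrite /= => u.
move=> [f0 st]; have sAB := staircase_size st.
move: u; rewrite mem_cat negb_or => /andP[/andP[aA abB] uAB].
have uaB : uniq (a :: b :: B).
  by rewrite cons_uniq abB; move: uAB; rewrite cat_uniq => /and3P[].
have hf' : f \is (size (b :: B)).+1.-homog by rewrite /= -sAB.
have [p [q [hp hq fE]]] := fan_ideal gen large uaB hf' f0.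
have [|||c [hc pE]] := IH B p.
- by move: uAB; rewrite !cat_uniq /= negb_or => /and3P[-> /andP[_ ->] /andP[_ ->]].
- by rewrite sAB.
- rewrite -[A]map_id -[B]map_id; apply: staircase_map st => i j iA jB fij /=.
  have uija : uniq [:: i; j; a].
    apply/uniq3P; split.
    - move: uAB; rewrite cat_uniq => /and3P[_ /hasPn/(_ j) + _].
      by rewrite inE jB orbT => /(_ isT); apply: contraNneq => <-.
    - by apply: contraNneq aA => <-.
    - by apply: contraNneq abB => <-; rewrite inE jB orbT.
  apply: (cancel_lin gen large uija) => x xi xj.
  have -> : lin a * p = f - (\prod_(k <- b :: B) lin k) * q by rewrite fE; ring.
  rewrite mevalB mevalM fij // (prod_lin_vanish (j := j)) ?mul0r ?subr0 //.
  by rewrite inE jB orbT.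
exists (fun t => if t is t'.+1 then c t' else q); split; first by case.
rewrite fE {1}pE /=; congr (_ + _ * _).
rewrite sAB -[(size B).+1]/(size (b :: B)) (big_nth b) big_mkord.
by apply: eq_bigr => i _; rewrite -[RHS]/(lins (b :: B) i) (nth_map b).
Qed.

Lemma homog1_msize (f : {mpoly C[4]}) : f \is 1.-homog -> (msize f <= 2)%N.
Proof.
move=> /dhomogP hf; rewrite msizeE; apply/bigmax_leqP_seq => m mf _.
by rewrite [X in (X < _)%N](hf m mf).
Qed.

Lemma staircase_determinant A B f : uniq (A ++ B) -> f \is (size A).+1.-homog ->
  staircase (vanishes_on_line h f) A B ->
  exists M : 'M[{mpoly C[4]}]_((size A).+1),
    (forall i j, (msize (M i j) <= 2)%N) /\ f = \det M.
Proof.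
move=> u hf /(staircase_ideal u hf)[c [hc ->]].
exists (staircase_mx (size A) (lins A) (lins B) c); rewrite det_staircase; split=> // i j.
apply: homog1_msize; rewrite mxE.
have hlins s t : lins s t \is 1.-homog.
  elim: s t => [|k s IH] [|t] //=; rewrite ?dhomog0 //; exact: linear_form_homog.
case: ifP => _ //; case: ifP => _ //; case: ifP => _; last exact: dhomog0.
by rewrite rpredN.
Qed.

End StaircaseRepresentation.

Section SingularPoint.
Variables (C : numFieldType) (I : eqType) (h : I -> 'cV[C]_4).
Hypothesis gen : general_position h.
Hypothesis large : forall s : seq I, (size s < 4)%N -> exists i, i \notin s.

(* The three lines through the triple point span its tangent space. *)
Lemma triple_point_singular (f : {mpoly C[4]}) i j k : uniq [:: i; j; k] ->
  vanishes_on_line h f i j -> vanishes_on_line h f i k -> vanishes_on_line h f j k ->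
  exists x : 'rV_4, [/\ x != 0, f.@[x 0] = 0 & forall r, (f^`M(r)).@[x 0] = 0].
Proof.
move=> u fij fik fjk; have [l nl] := large (isT : (size [:: i; j; k] < 4)%N).
have u4 : uniq [:: i; j; k; l].
  by rewrite -[[:: _; _; _; _]]/(rcons [:: i; j; k] l) rcons_uniq nl.
have [x [xi xj xk xl]] := form_solve gen 0 0 0 1 u4.
have [ei [eii eij eik eil]] := form_solve gen 1 0 0 0 u4.
have [ej [eji ejj ejk ejl]] := form_solve gen 0 1 0 0 u4.
have [ek [eki ekj ekk ekl]] := form_solve gen 0 0 1 0 u4.
pose grad (y : 'rV[C]_4) := \sum_r y 0 r * (f^`M(r)).@[x 0].
have gradD y z : grad (y + z) = grad y + grad z.
  by rewrite -big_split; apply: eq_bigr => r _ /=; rewrite mxE mulrDl.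
have gradZ a y : grad (a *: y) = a * grad y.
  by rewrite mulr_sumr; apply: eq_bigr => r _; rewrite mxE mulrA.
have tangent a b y : vanishes_on_line h f a b -> form h a x = 0 -> form h b x = 0 ->
    form h a y = 0 -> form h b y = 0 -> grad y = 0.
  move=> fab xa xb ya yb; apply: directional_derivative => t; apply: fab.
    by rewrite formD formZ xa ya mulr0 addr0.
  by rewrite formD formZ xb yb mulr0 addr0.
exists x; split.
- by apply: contra_eq_neq xl => ->; rewrite form0 eq_sym oner_neq0.
- exact: fij.
move=> r; pose y : 'rV[C]_4 := delta_mx 0 r.
have -> : (f^`M(r)).@[x 0] = grad y.
  rewrite /grad (bigD1 r) //= big1 ?addr0 => [|s sr]; first by rewrite mxE !eqxx mul1r.
  by rewrite mxE (negPf sr) andbF mul0r.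
(* Coordinates in the basis dual to the four forms, with [x] as its last member. The first three
   vectors point along the three lines, and [x] itself lies on them, so the gradient kills all
   four. *)
pose z := form h i y *: ei + form h j y *: ej + form h k y *: ek + form h l y *: x.
have -> : y = z.
  apply/eqP; rewrite -subr_eq0; apply/eqP; apply: (gen4 gen u4);
  rewrite formB !formD !formZ ?xi ?xj ?xk ?xl ?eii ?eij ?eik ?eil ?eji ?ejj ?ejk ?ejl
    ?eki ?ekj ?ekk ?ekl; ring.
rewrite !gradD !gradZ (tangent j k ei) // (tangent i k ej) // (tangent i j ek) //.
by rewrite (tangent i j x) // !mulr0 !addr0.
Qed.
End SingularPoint.

(** * Zariski density of a convex real set in its complex span *)

Section Density.
Variable R : realType.
Local Notation C := R[i].
Local Notation cmx := (map_mx (real_complex R)).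

Lemma dhomog_scale d (f : {mpoly C[4]}) a (x : 'rV[C]_4) : f \is d.-homog ->
  f.@[(a *: x) 0] = a ^+ d * f.@[x 0].
Proof.
move=> hf; rewrite !mevalE mulr_sumr big_seq [RHS]big_seq; apply: eq_bigr => m mf.
have -> : d = mdeg m by rewrite -(dhomog_mf hf mf).
rewrite mulrCA; congr (_ * _); rewrite mdegE -prodrXr -big_split.
by apply: eq_bigr => i _ /=; rewrite mxE exprMn.
Qed.

(** Enough convexity for adding a point of [F] to a positive natural multiple of a point of [F] to
    give such a multiple again. *)
Definition nat_convex (F : set 'rV[R]_4) := forall x y (n : nat), F x -> F y ->
  F (n.+1%:R^-1 *: (n%:R *: x + y)).

(* By convexity and homogeneity [f] vanishes at all combinations of points of [F]
   whose coefficients are natural numbers, not all zero; these coefficients can be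
   replaced by complex numbers one after the other. *)
Lemma span_vanish (F : set 'rV[R]_4) m (M : 'M[R]_(m, 4)) d (f : {mpoly C[4]}) q :
  nat_convex F -> F q -> (forall i, F (row i M)) -> (q <= M)%MS -> f \is d.-homog ->
  (forall x, F x -> f.@[cmx x 0] = 0) ->
  forall x : 'rV[C]_4, (x <= cmx M)%MS -> f.@[x 0] = 0.
Proof.
move=> cF Fq FM qM hf fF.
pose stable (B : set 'rV[C]_4) := (forall b p, B b -> F p -> B (b + cmx p)) /\
  (forall b, B b -> f.@[b 0] = 0).
have stable0 : stable [set b | exists n x, F x /\ b = n.+1%:R *: cmx x].
  split=> [b p [n [x [Fx ->]]] Fp|b [n [x [Fx ->]]]]; last first.
    by rewrite (dhomog_scale _ _ hf) fF // mulr0.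
  exists n.+1, (n.+2%:R^-1 *: (n.+1%:R *: x + p)); split; first exact: cF.
  rewrite map_mxZ map_mxD map_mxZ fmorphV !rmorph_nat scalerA divff ?scale1r //.
  by rewrite pnatr_eq0.
have stableS B p : stable B -> F p -> stable [set b | exists c t, B c /\ b = c + t *: cmx p].
  move=> [BF fB] Fp; split=> [_ p' [c [t [Bc ->]]] Fp'|_ [c [t [Bc ->]]]].
    by exists (c + cmx p'), t; split; [apply: BF | rewrite addrAC].
  move: t; apply: vanish_on_line => n; apply: fB.
  elim: n => [|n IH]; first by rewrite scale0r addr0.
  by rewrite -natr1 scalerDl scale1r addrA; apply: BF.
have stable_sum (s : seq 'I_m) B (t : 'I_m -> C) b : stable B -> B b ->
    f.@[(b + \sum_(i <- s) t i *: cmx (row i M)) 0] = 0.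
  elim: s B b => [|i s IH] B b sB Bb; first by rewrite big_nil addr0; apply sB.2.
  rewrite big_cons addrA; apply: (IH _ _ (stableS _ _ sB (FM i))).
  by exists b, (t i).
move=> x xM.
have qMC : (cmx q <= cmx M)%MS by rewrite map_submx.
have /submxP[D DE] : (x - cmx q <= cmx M)%MS by rewrite addmx_sub // eqmx_opp.
have -> : x = cmx q + \sum_(i <- index_enum 'I_m) D 0 i *: cmx (row i M).
  rewrite -[LHS](subrK (cmx q)) addrC; congr (_ + _); rewrite DE mulmx_sum_row.
  by apply: eq_bigr => i _; rewrite map_row.
apply: stable_sum stable0 _; exists 0%N, q; split=> //.
by rewrite scale1r.
Qed.

(** Ranks are bounded by 4, so some finite family of points of [F] has maximal rank; a point outside
    its span could be adjoined. *)
Lemma spanning_points (F : set 'rV[R]_4) : exists m (M : 'M[R]_(m, 4)),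
  (forall i, F (row i M)) /\ (forall x, F x -> (x <= M)%MS).
Proof.
pose Q r := `[< exists m (M : 'M[R]_(m, 4)), (forall i, F (row i M)) /\ \rank M = r >].
have ex : exists r, Q r.
  by exists 0%N; apply/asboolP; exists 0%N, 0; split; [case | rewrite mxrank0].
have bnd r : Q r -> (r <= 4)%N.
  by move=> /asboolP[m [M [_ <-]]]; apply: rank_leq_col.
case: (ex_maxnP ex bnd) => r /asboolP[m [M [FM rM]]] rmax.
exists m, M; split=> // x Fx; apply: contraT => xM.
have : Q (\rank (col_mx M x)).
  apply/asboolP; exists (m + 1)%N, (col_mx M x); split=> // i.
  rewrite -(splitK i); case: (fintype.split i) => j /=.
    by rewrite rowKu.
  by rewrite rowKd ord1 row_id.
move=> /rmax; rewrite -rM leqNgt rank_ltmx // ltmxE col_mx_sub submx_refl xM andbT.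
by rewrite -addsmxE addsmxSl.
Qed.
End Density.

(** * Facets of a polytope *)

Section Facets.
Variable R : realType.
Local Notation C := R[i].
Local Notation cmx := (map_mx (real_complex R)).
Implicit Types (P F : set 'rV[R]_4).

Lemma polytope_convex P : polytope3 P -> nat_convex P.
Proof.
move=> [l [n [v [_ -> _]]]] x y N [w [w0 w1 ->]] [w' [w'0 w'1 ->]].
exists (fun i => N.+1%:R^-1 * (N%:R * w i + w' i)); split.
- by move=> i; rewrite mulr_ge0 ?invr_ge0 ?ler0n // addr_ge0 ?mulr_ge0 ?ler0n.
- rewrite -mulr_sumr big_split /= -mulr_sumr w1 w'1 mulr1 natr1 mulVf //.
  by rewrite pnatr_eq0.
- rewrite !scaler_sumr -big_split scaler_sumr; apply: eq_bigr => i _ /=.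
  by rewrite -scalerA scalerDl scalerA.
Qed.

Lemma polytope_neq0 P x : polytope3 P -> P x -> x != 0.
Proof.
move=> [l [n [v [vl -> _]]]] [w [_ w1 ->]]; apply/eqP=> x0.
have : ((\sum_i w i *: v i) *m l) 0 0 = 1.
  rewrite mulmx_suml summxE -[RHS]w1; apply: eq_bigr => i _.
  by rewrite -scalemxAl mxE vl mulr1.
by rewrite x0 mul0mx mxE => /eqP; rewrite eq_sym oner_eq0.
Qed.

Lemma has_dim_inj F d e : has_dim F d -> has_dim F e -> d = e.
Proof.
move=> [A [[FA Amin] rA]] [B [[FB Bmin] rB]].
apply: succn_inj; rewrite -rA -rB; apply/eqP; rewrite eqn_leq.
by rewrite !mxrankS // ?(Amin _ FB) ?(Bmin _ FA).
Qed.

(** The last clause turns dimension 2 into the form needed for density: finitely many points of [F]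
    span the whole plane of [h]. *)
Definition facet_form P F (h : 'cV[R]_4) :=
  [/\ forall x, P x -> 0 <= (x *m h) 0 0,
      F = [set x | P x /\ (x *m h) 0 0 = 0] &
      exists q m (M : 'M[R]_(m, 4)),
        [/\ F q, forall i, F (row i M) & (kermx h <= M)%MS]].

Lemma facet_formP P F : polytope3 P -> facets P F -> exists h, facet_form P F h.
Proof.
move=> polP [[[q Fq] [h [hP FE]]] dF]; exists h; split=> //.
have [m [M [FM sM]]] := spanning_points F; exists q, m, M; split=> //.
have [A [[FA Amin] rA]] := dF.
have rM : \rank M = 3%N.
  apply: etrans rA; apply/eqP; rewrite eqn_leq; apply/andP; split; apply: mxrankS.
    by apply/row_subP=> i; apply/FA/FM.
  by rewrite -(genmxE M); apply: Amin => x /sM; rewrite genmxE.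
have h0 : h != 0.
  apply/eqP=> h0; have FP : F = P.
    by rewrite FE h0; apply/seteqP; split=> x /=; rewrite mulmx0 mxE; [case|].
  have [_ [_ [_ [_ _ dP]]]] := polP.
  by move: dF; rewrite FP => /(has_dim_inj dP).
have Mh : (M <= kermx h)%MS.
  apply/sub_kermxP/row_matrixP=> i; rewrite row_mul row0.
  by apply/matrixP=> a b; rewrite !ord1 [RHS]mxE; move: (FM i); rewrite FE => -[].
rewrite -(mxrank_leqif_sup Mh) rM mxrank_ker.
have : (0 < \rank h)%N by rewrite lt0n mxrank_eq0.
by have := rank_leq_col h; case: (\rank h) => [|[|r]].
Qed.

(* In [zariski_closure] the condition [x != 0] is elaborated as an inequality of
   functions ['I_1 -> 'I_4 -> C], not of matrices. *)
Lemma zariski_closureE (S : set 'rV[C]_4) : zariski_closure S =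
  [set x : 'rV[C]_4 | (x != 0 :> 'rV[C]_4) /\
     forall (d : nat) (f : {mpoly C[4]}), f \is d.-homog ->
       (forall y, S y -> f.@[y 0] = 0) -> f.@[x 0] = 0].
Proof.
apply/seteqP; split=> x /= [/eqP x0 Hx]; split=> //; apply/eqP=> e; apply: x0.
  by apply/funext=> i; apply/funext=> j; rewrite e mxE.
by apply/matrixP=> i j; rewrite mxE e.
Qed.

(** The linear form of [h] is itself one of the polynomials vanishing on [F], which bounds the
    closure; the converse is the density of [F] in the complex plane. *)
Lemma facet_closure P F h : polytope3 P -> facet_form P F h ->
  zariski_closure (complex_points F) =
  [set x : 'rV[C]_4 | (x != 0 :> 'rV[C]_4) /\ (x *m cmx h) 0 0 = 0].
Proof.
move=> polP [hP FE [q [m [M [Fq FM kM]]]]].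
have F0 x : F x -> (x *m h) 0 0 = 0 by rewrite FE => -[].
rewrite zariski_closureE; apply/seteqP; split=> x /= [x0 Hx]; split=> //.
  rewrite -linear_form_eval; apply: (Hx 1%N (linear_form (cmx h)) (linear_form_homog _)).
  move=> _ [y Fy <-]; rewrite linear_form_eval -map_mxM mxE F0 // rmorph0 //.
move=> d f hf fF.
have xM : (x <= cmx M)%MS.
  have : (x <= kermx (cmx h))%MS.
    by apply/sub_kermxP/matrixP=> a b; rewrite !ord1 [RHS]mxE Hx.
  by move/submx_trans; apply; rewrite -map_kermx map_submx.
apply: (span_vanish _ Fq FM _ hf _ xM).
- move=> y z n; rewrite FE => -[Py yh] [Pz zh]; split; first exact: polytope_convex.
  rewrite -scalemxAl mulmxDl -scalemxAl !mxE; move: yh zh; rewrite !mxE => -> ->.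
  by rewrite !(mulr0, addr0).
- apply: submx_trans kM; apply/sub_kermxP/matrixP=> a b.
  by rewrite !ord1 [RHS]mxE F0.
- by move=> y Fy; apply: fF; exists y.
Qed.
End Facets.

(** * The planes of the facets and the residual lines *)

Section FacetArrangement.
Variable R : realType.
Local Notation C := R[i].
Local Notation cmx := (map_mx (real_complex R)).
Variables (P : set 'rV[R]_4) (k : nat) (F : 'I_k -> set 'rV[R]_4) (h : 'I_k -> 'cV[R]_4).
Hypothesis polP : polytope3 P.
Hypothesis simpleP : simple_arrangement (facet_arrangement P).
Hypothesis facetF : forall i, facets P (F i).
Hypothesis injF : injective F.
Hypothesis hF : forall i, facet_form P (F i) (h i).
Hypothesis k4 : (3 < k)%N.

Let hC i := cmx (h i).
Let H i := zariski_closure (complex_points (F i)).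

Lemma planeE i : H i = [set x : 'rV[C]_4 | (x != 0 :> 'rV[C]_4) /\ form hC i x = 0].
Proof. exact: (facet_closure polP (hF i)). Qed.

Lemma form_cmx i x : form hC i (cmx x) = (form h i x)%:C%C.
Proof. by rewrite /form -map_mxM mxE. Qed.

Lemma on_plane i x : P x -> H i (cmx x) -> form h i x = 0.
Proof.
by move=> Px; rewrite planeE => -[_]; rewrite form_cmx => /(congr1 (@complex.Re R)).
Qed.

(** A facet is recovered from its plane as the intersection with [P]. *)
Lemma plane_inj : injective H.
Proof.
move=> i j Hij; apply: injF.
have sub a b : H a = H b -> F a `<=` F b.
  move=> Hab x; have [_ Ea _] := hF a; have [_ -> _] := hF b.
  rewrite Ea => -[Px xa]; split=> //; apply: on_plane => //; rewrite -Hab planeE.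
  split; last by rewrite form_cmx /form xa.
  by rewrite map_mx_eq0 (polytope_neq0 polP).
by apply/seteqP; split; apply: sub.
Qed.

Lemma large_index (s : seq 'I_k) : (size s < 4)%N -> exists i, i \notin s.
Proof.
move=> s4; apply: contrapT => no.
have sub : {subset enum 'I_k <= s}.
  by move=> i _; apply: contrapT => /negP nis; apply: no; exists i.
have := uniq_leq_size (enum_uniq 'I_k) sub.
by rewrite size_enum_ord leqNgt (leq_trans s4 k4).
Qed.

(** Simplicity concerns sets of planes; distinct indices give distinct planes, so four of them form
    a set of cardinality 4, whose intersection is empty. *)
Lemma complex_general_position : general_position hC.
Proof.
move=> s x us s4 sx; apply/eqP; apply: contraT => x0.
have i0 : 'I_k by apply: (Ordinal (ltn_trans (isT : (0 < 3)%N) k4)).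
pose S := [set H (nth i0 s n) | n in `I_4].
have SA : S `<=` facet_arrangement P.
  by move=> _ [n _ <-]; exists (F (nth i0 s n)).
have S4 : S #= `I_4.
  apply: inj_card_eq => m n; rewrite !inE /= => m4 n4 /plane_inj/eqP.
  by rewrite nth_uniq ?s4 // => /eqP.
have [_ /(_ isT) S0] := simpleP SA S4.
suff : intersection S x by rewrite S0.
split=> // _ [n /= n4 <-]; rewrite planeE; split=> //.
by apply: sx; rewrite mem_nth ?s4.
Qed.

Lemma real_general_position : general_position h.
Proof.
move=> s x us s4 sx; apply/eqP; rewrite -(map_mx_eq0 (real_complex R)); apply/eqP.
by apply: (complex_general_position us s4) => i si; rewrite form_cmx sx.
Qed.

(** If another form vanished on the whole facet, it would vanish on the plane spanned by it, against
    general position. So each other form is positive somewhere on the facet, and the sum of these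
    points works for all at once; only signs matter, so it need not lie in [P]. *)
Lemma facet_interior_point i :
  exists x, form h i x = 0 /\ forall j, j != i -> 0 < form h j x.
Proof.
have [hPi FE [q [m [M [Fq FM kM]]]]] := hF i.
have Fi y : F i y -> P y /\ form h i y = 0 by rewrite FE.
have /choice[y yP] : forall j, exists y, F i y /\ (j != i -> 0 < form h j y).
  move=> j; apply: contrapT => no.
  have ji : j != i by apply/eqP=> e; apply: no; exists q; rewrite e eqxx.
  have yj y : F i y -> form h j y = 0.
    move=> Fy; have [Py _] := Fi y Fy; have [hPj _ _] := hF j.
    apply/eqP; rewrite eq_le hPj // andbT leNgt; apply/negP=> pos; apply: no.
    by exists y.
  have kj : (kermx (h i) <= kermx (h j))%MS.
    apply: (submx_trans kM); apply/sub_kermxP/row_matrixP=> a; rewrite row_mul row0.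
    by apply/matrixP=> b c; rewrite !ord1 [RHS]mxE; apply: (yj _ (FM a)).
  have [a na] := large_index (isT : (size [:: i; j] < 4)%N).
  have [b nb] := large_index (isT : (size [:: i; j; a] < 4)%N).
  have u4 : uniq [:: i; j; a; b].
    rewrite -[[:: _; _; _; _]]/(rcons [:: i; j; a] b) rcons_uniq nb.
    by rewrite -[[:: _; _; _]]/(rcons [:: i; j] a) rcons_uniq na /= inE eq_sym ji.
  have [x [xi xj _ _]] := form_solve real_general_position 0 1 0 0 u4.
  have : (x <= kermx (h j))%MS.
    by apply: submx_trans kj; apply/sub_kermxP/matrixP=> b' c; rewrite !ord1 [RHS]mxE; apply: xi.
  move/sub_kermxP/matrixP/(_ 0 0); rewrite [RHS]mxE; move: xj; rewrite /form => -> /eqP.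
  by rewrite oner_eq0.
have sumE j : form h j (\sum_l y l) = \sum_l form h j (y l).
  by rewrite /form mulmx_suml summxE.
exists (\sum_l y l); split.
  by rewrite sumE big1 // => l _; case: (yP l) => /Fi[].
move=> j ji; rewrite sumE (bigD1 j) //=; apply: ltr_pwDl.
  by case: (yP j) => _; apply.
apply: sumr_ge0 => l _; have [hPj _ _] := hF j.
by apply: hPj; case: (yP l) => /Fi[].
Qed.

Lemma facet_system : face_system (edge_of h) (face_of h).
Proof.
apply: arrangement_face_system.
- exact: real_general_position.
- exact: facet_interior_point.
- exact: large_index.
Qed.

(* No point of P lies on both facets, so the line in which their planes meet
   contains no face of P and is residual. *)
Lemma nonadjacent_residual d (f : {mpoly C[4]}) i j : f \is d.+1.-homog ->
  (forall L, residual_arrangement P L -> forall x : 'rV_4, L x -> f.@[x 0] = 0) ->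
  i != j -> ~ edge_of h (enum 'I_k) i j -> vanishes_on_line hC f i j.
Proof.
move=> hf fres ij ne x xi xj; have [->|x0] := eqVneq x 0.
  by have := dhomog_scale 0 (0 : 'rV[C]_4) hf; rewrite scale0r expr0n mul0r.
apply: (fres (intersection [set H i; H j])); last first.
  have [Hi Hj] : H i x /\ H j x by rewrite !planeE.
  by split; [exact: x0 | move=> _ [->|->]].
split; first by exists [set H i; H j] => // _ [->|->]; [exists (F i)|exists (F j)].
move=> G [[q Gq] [g [_ GE]]] sub; apply: ne.
have Pq : P q by move: Gq; rewrite GE => -[].
have [_ qH] := sub (cmx q) (ex_intro2 _ _ q Gq erefl).
apply: (nonneg_edge real_general_position large_index ij (polytope_neq0 polP Pq)).
- by apply: on_plane => //; apply: qH; left.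
- by apply: on_plane => //; apply: qH; right.
- by move=> l _; have [+ _ _] := hF l; apply.
Qed.
End FacetArrangement.

Theorem corollary6p6 :
  forall (R : realType) (P : set 'rV[R]_4) (k : nat) (alpha : {mpoly R[i][4]}),
    polytope3 P ->
    simple_arrangement (facet_arrangement P) ->
    adjoint_polynomial P k alpha ->
    ((k <= 8)%N -> has_determinantal_representation (k - 4) alpha) /\
    (smooth_hypersurface alpha -> has_determinantal_representation (k - 4) alpha).
Proof.
move=> R P k alpha polP simpleP [card a0 ah ares].
have [k4|k5] := leqP k 4.
  suff D : has_determinantal_representation (k - 4) alpha by split.
  (* Truncated subtraction gives degree 0 for every k <= 4. The scalar then has to turn the constant
     into 1, the determinant of the empty matrix. *)
  move: ah; have -> : (k - 4 = 0)%N by apply/eqP; rewrite subn_eq0.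
  move=> ah; have [c alphaE] : exists c, alpha = c%:MP.
    exists alpha@_0; apply/mpolyP=> m; rewrite mcoeffC.
    have [->|m0] := eqVneq 0%MM m; first by rewrite mulr1.
    by rewrite mulr0 (dhomog_nemf_coeff ah) // mdeg_eq0 eq_sym.
  have c0 : c != 0 by move: a0; rewrite alphaE mpolyC_eq0.
  exists c^-1; split; first by rewrite invr_eq0.
  exists (const_mx 0); split; first by case.
  by rewrite det_mx00 alphaE -mul_mpolyC -mpolyCM mulVf.
have [F [Ffac injF]] : exists F : 'I_k -> set 'rV[R]_4,
    (forall i, facets P (F i)) /\ injective F.
  move: card; rewrite card_eq_sym => /card_set_bijP[f [fun_f inj_f _]].
  exists (fun i => f i); split=> [i|i j /inj_f e]; first exact/fun_f/ltn_ord.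
  by apply/val_inj/e; rewrite inE; apply: ltn_ord.
have /choice[h hF] := fun i => facet_formP polP (Ffac i).
have kgt3 : (3 < k)%N by apply: ltnW.
have gen := complex_general_position polP simpleP Ffac injF hF kgt3.
have large := large_index kgt3.
have fs := facet_system polP simpleP Ffac injF hF kgt3.
have ah1 : alpha \is ((k - 5).+1).-homog by rewrite -subSn // subSS.
have van i j := nonadjacent_residual polP simpleP Ffac injF hF kgt3 ah1 ares (i := i) (j := j).
have usize : size (enum 'I_k) = k by rewrite size_enum_ord.
have rep : (k <= 8)%N -> has_determinantal_representation (k - 4) alpha.
  move=> k8; have i0 : 'I_k by apply: (Ordinal (ltn_trans (isT : (0 < 4)%N) k5)).
  have [|A [B [sA uAB _ st]]] := staircase_exists i0 fs (enum_uniq 'I_k).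
    by rewrite usize k5 k8.
  rewrite usize in sA.
  have kE : (k - 4 = (size A).+1)%N by rewrite sA -subSn // subSS.
  have stv : staircase (vanishes_on_line (fun i => map_mx (real_complex R) (h i)) alpha) A B.
    rewrite -[A]map_id -[B]map_id; apply: staircase_map st => i j iA jB ne.
    apply: van => //; move: uAB; rewrite cat_uniq => /and3P[_ /hasPn/(_ j jB) + _].
    by apply: contraNneq => <-.
  have [|M [Msz alphaM]] := staircase_determinant gen large uAB _ stv.
    by rewrite sA.
  exists 1; rewrite oner_neq0; split=> //; rewrite kE; exists M.
  by split; rewrite ?scale1r.
split=> // smooth; have [/rep//|k9] := leqP k 8.
(* With nine or more facets the surface has a singular point, so smoothness is contradictory
   here. *)
have i0 : 'I_k by apply: (Ordinal (ltn_trans (isT : (0 < 4)%N) k5)).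
have [|x [y [z [_ u xy xz yz]]]] := anticlique_exists i0 fs (enum_uniq 'I_k).
  by rewrite usize.
have [nxy nxz nyz] := uniq3P _ _ _ u.
have [p [p0 ap dp]] :=
  triple_point_singular gen large u (van _ _ nxy xy) (van _ _ nxz xz) (van _ _ nyz yz).
by have [r] := smooth p p0 ap; rewrite dp eqxx.
Qed.
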